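(* Let $E\subset\mathbb{R}^d$ and let $(E,d_E)$ be a complete, bounded metric space with $\sup_{\mathbf{x}_1,\mathbf{x}_2\in E}d_E(\mathbf{x}_1,\mathbf{x}_2)\le D<\infty$. Let $P_0^r\in\mathcal{W}_2(E)$ (the real prior) and $P_0^g\in\mathcal{W}_2(E)$ (the generated prior) be probability distributions with PDFs $\rho_0^r$ and $\rho_0^g$. For fixed data $\mathbf{y}$, let the real and generated likelihoods satisfy $$\rho_{y|u}^r(\mathbf{y}|\mathbf{u})\propto\Phi^r(\mathbf{u})=e^{-l^r(\mathbf{u})},\qquad \rho_{y|u}^g(\mathbf{y}|\mathbf{u})\propto\Phi^g(\mathbf{u})=e^{-l^g(\mathbf{u})},$$ with $l^r,l^g:E\to\mathbb{R}_+$ and $\Phi^r,\Phi^g:E\to\mathbb{R}_+$, where $\Phi^r$ and $\Phi^g$ are Lipschitz continuous with Lipschitz constants $\mathrm{Lip}(\Phi^r)$ and $\mathrm{Lip}(\Phi^g)$, and $\Phi^r,\Phi^g\in L^2_{\rho_0^g}$. Let $P^r_{u|y}$ and $P^g_{u|y}$ be the real and generated posterior distributions, with PDFs $\Phi^r\rho_0^r/Q_u^r(\mathbf{y})$ and $\Phi^g\rho_0^g/Q_u^g(\mathbf{y})$, where $Q_u^r(\mathbf{y})=\int_E\Phi^r(\mathbf{u})\rho_0^r(\mathbf{u})\,\mathrm{d}\mathbf{u}$ and $Q_u^g(\mathbf{y})=\int_E\Phi^g(\mathbf{u})\rho_0^g(\mathbf{u})\,\mathrm{d}\mathbf{u}$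 are the evidences. Assume that $$W_1(P_0^r,P_0^g)\le\epsilon_1,\qquad \|l^r-l^g\|_{L^1_{\rho_0^g}}\le\epsilon_2,\qquad \|l^r-l^g\|_{L^2_{\rho_0^g}}\le\epsilon_3.$$ Then $$W_1(P_{u|y}^r,P_{u|y}^g)\le C_1\epsilon_1+C_2\epsilon_2+C_3\epsilon_3,$$ where $$C_1=\frac{1+D\,\mathrm{Lip}(\Phi^r)}{Q_u^r(\mathbf{y})},\qquad C_2=\frac{\max(\Phi^r,\Phi^g)}{Q_u^r(\mathbf{y})\,Q_u^g(\mathbf{y})}\,(1+D\,\mathrm{Lip}(\Phi^r))\,|P_0^g|_{\mathcal{W}_1},\qquad C_3=\frac{\max(\Phi^r,\Phi^g)}{Q_u^g(\mathbf{y})}\,|P_0^g|_{\mathcal{W}_2},$$ and $\max(\Phi^r,\Phi^g)$ denotes the maximum (supremum) over $\mathbf{u}\in E$ of the values of $\Phi^r(\mathbf{u})$ and $\Phi^g(\mathbf{u})$.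
   Context: All probability distributions are assumed to have probability density functions (PDFs). For a probability distribution $P$ on $E$ with PDF $\rho$ and $q\ge1$, set $$|P|_{\mathcal{W}_q}=\inf_{x_0\in E}\left(\int_E d_E(x,x_0)^q\rho(x)\,\mathrm{d}x\right)^{1/q},\qquad \mathcal{W}_q(E)=\{P: |P|_{\mathcal{W}_q}<\infty\}.$$ The Wasserstein-1 distance between $P_1,P_2\in\mathcal{W}_1(E)$ with PDFs $\rho_1,\rho_2$ is $$W_1(P_1,P_2)=\inf_{\gamma\in\Gamma(P_1,P_2)}\int_E\int_E d_E(x,y)\,\gamma(x,y)\,\mathrm{d}x\,\mathrm{d}y,$$ where $\Gamma(P_1,P_2)$ is the set of couplings, i.e. joint distributions (written via densities $\gamma$) with marginals $P_1$ and $P_2$; by Kantorovich–Rubinstein duality it equals $$W_1(P_1,P_2)=\sup_{\mathrm{Lip}(f)\le1}\left|\int_E f(x)\rho_1(x)\,\mathrm{d}x-\int_E f(x)\rho_2(x)\,\mathrm{d}x\right|,$$ the supremum being over functions $f:E\to\mathbb{R}$ that are Lipschitz with respect to $d_E$ with Lipschitz constant $\mathrm{Lip}(f)\le 1$. The Lipschitz constants of $\Phi^r,\Phi^g$ are also with respect to $d_E$. The weighted norms are $$\|f\|_{L^1_\rho}=\int|f(x)|\rho(x)\,\mathrm{d}x,\qquad \|f\|_{L^2_\rho}=\left(\int|f(x)|^2\rho(x)\,\mathrm{d}x\right)^{1/2}.$$ The evidences $Q_u^r(\mathbf{y}),Q_u^g(\mathbf{y})$ are understood to be positive and finite, so that the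 posteriors are well-defined. *)

(* Defs.v *)
From HB Require Import structures.
From mathcomp Require Import all_boot all_order all_algebra.
From mathcomp Require Import all_classical all_reals all_analysis.

Set Implicit Arguments.
Unset Strict Implicit.
Unset Printing Implicit Defensive.

Import Order.TTheory GRing.Theory Num.Theory.
Import numFieldNormedType.Exports.

Local Open Scope classical_set_scope.
Local Open Scope ring_scope.

(* R^n is n.-tuple R, which carries the product sigma-algebra, i.e. the Borel
   sigma-algebra of R^n.  The library only has the Lebesgue measure on R; the
   one on R^n is built by induction, R^(n+1) being R x R^n through
   (x, v) |-> x :: v. *)
Section lebesgue_step.
Context {R : realType} (n : nat).
Variable m : {sigma_finite_measure set (n.-tuple R) -> \bar R}.

Definition vcons (p : measurableTypeR R * n.-tuple R) : n.+1.-tuple R :=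
  [tuple of p.1 :: p.2].

Definition vuncons (v : n.+1.-tuple R) : measurableTypeR R * n.-tuple R :=
  (thead v, [tuple of behead v]).

Lemma vconsK : cancel vcons vuncons.
Proof.
by move=> [x v]; congr pair; exact/val_inj.
Qed.

Lemma measurable_vcons : measurable_fun setT vcons.
Proof. exact: (measurable_cons measurable_fst measurable_snd). Qed.

Lemma measurable_vuncons : measurable_fun setT vuncons.
Proof.
apply/measurable_fun_pairP; split; first exact: (measurable_tnth ord0).
exact: measurable_behead.
Qed.

Definition lebesgue_step (A : set (n.+1.-tuple R)) : \bar R :=
  pushforward (@lebesgue_measure R \x m)%E vcons A.

Let step0 : lebesgue_step set0 = 0%E.
Proof. by rewrite /lebesgue_step /pushforward preimage_set0 measure0. Qed.

Let step_ge0 A : (0 <= lebesgue_step A)%E.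
Proof. exact: (measure_ge0 (@lebesgue_measure R \x m)%E). Qed.

Let step_sigma_additive : semi_sigma_additive lebesgue_step.
Proof.
exact: (@measure_semi_sigma_additive _ _ _
  (measure_function_pushforward__canonical__measure_function_Measure
     (@lebesgue_measure R \x m)%E measurable_vcons)).
Qed.

HB.instance Definition _ := isMeasure.Build _ _ _ lebesgue_step
  step0 step_ge0 step_sigma_additive.

Let step_sigma_finite : sigma_finite setT lebesgue_step.
Proof.
have /sigma_finiteP[F [TF ndF Foo]] := sigma_finiteT (@lebesgue_measure R).
have /sigma_finiteP[G [TG ndG Goo]] := sigma_finiteT m.
exists (fun k => vuncons @^-1` (F k `*` G k)).
  apply/seteqP; split=> // v _.
  have : setT (vuncons v).1 by []. rewrite TF => -[i _ Fi].
  have : setT (vuncons v).2 by []. rewrite TG => -[j _ Gj].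
  exists (maxn i j) => //; split.
    by move: Fi; exact/subsetPset/ndF/leq_maxl.
  by move: Gj; exact/subsetPset/ndG/leq_maxr.
move=> k; have [mF Fk] := Foo k; have [mG Gk] := Goo k; split.
  rewrite -[X in measurable X]setTI.
  by apply: measurable_vuncons => //; exact: measurableX.
rewrite /lebesgue_step /pushforward (_ : _ @^-1` _ = F k `*` G k).
  by rewrite product_measure1E// lte_mul_pinfty// ge0_fin_numE.
by apply/funext => p; rewrite /preimage /mkset vconsK.
Qed.

HB.instance Definition _ := Measure_isSigmaFinite.Build _ _ _ lebesgue_step
  step_sigma_finite.

End lebesgue_step.

Fixpoint leb {R : realType} (n : nat) :
    {sigma_finite_measure set (n.-tuple R) -> \bar R} :=
  if n is k.+1 then lebesgue_step (leb k) else \d_([tuple] : 0.-tuple R).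

(* The measure of a box is the product of its side measures. *)
Lemma leb_box (R : realType) (n : nat) (A : nat -> set R) :
  (forall i, measurable (A i)) ->
  leb n [set v : n.-tuple R | forall i : 'I_n, A i (tnth v i)] =
  (\prod_(i < n) lebesgue_measure (A i))%E.
Proof.
elim: n A => [|n IH] A mA.
  rewrite big_ord0 /= diracE mem_set//= => -[].
  by [].
rewrite big_ord_recl -(IH (fun i => A i.+1))//= -product_measure1E//.
  rewrite /lebesgue_step /pushforward; congr (_ _).
  apply/seteqP; split=> -[x v] /=.
    move=> h; split; first by have := h ord0; rewrite (tnth_nth x).
    by move=> i; have := h (lift ord0 i); rewrite !(tnth_nth x).
  move=> [h0 h] i; case: (unliftP ord0 i) => [j ->|->].
    by have := h j; rewrite !(tnth_nth x).
  by rewrite (tnth_nth x).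
  exact: mA.
rewrite (_ : [set _ | _] = \bigcap_(i in [set: 'I_n])
    (@tnth n R ^~ i @^-1` A i.+1)).
  apply: fin_bigcap_measurable; first exact: finite_finset.
  move=> i _; rewrite -[X in measurable X]setTI.
  exact: (measurable_tnth i).
by apply/seteqP; split=> v /= h i; [move=> _|]; exact: h.
Qed.

(* The distance dE lives on a subset E of R^d and is unrelated to the norm of
   R^d; it is a function on all of R^d whose values outside E are irrelevant. *)
Section metric_on_subset.
Context {R : realType} {d : nat}.
Variables (E : set (d.-tuple R)) (dE : d.-tuple R -> d.-tuple R -> R).

Definition metric_on : Prop :=
  [/\ forall x y, E x -> E y -> 0 <= dE x y,
      forall x y, E x -> E y -> (dE x y = 0 <-> x = y),
      forall x y, E x -> E y -> dE x y = dE y x &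
      forall x y z, E x -> E y -> E z -> dE x z <= dE x y + dE y z].

Definition complete_on : Prop :=
  forall u : nat -> d.-tuple R, (forall n, E (u n)) ->
  (forall e, 0 < e -> exists N, forall m n, (N <= m)%N -> (N <= n)%N ->
     dE (u m) (u n) < e) ->
  exists2 x, E x & (fun n => dE (u n) x) @ \oo --> (0 : R).

Definition metric_open (U : set (d.-tuple R)) : Prop :=
  U `<=` E /\
  forall x, U x -> exists2 e, 0 < e & forall y, E y -> dE x y < e -> U y.

Definition separable_on : Prop :=
  exists S : set (d.-tuple R), [/\ countable S, S `<=` E &
    forall x e, E x -> 0 < e -> exists2 s, S s & dE x s < e].

(* Compatibility of dE with the Borel structure of R^d, without which
   dE-Lipschitz functions need not be measurable.  In particular E itself is
   Borel.  Both conditions hold as soon as E is Borel and dE is continuous for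
   the Euclidean topology of E. *)
Definition borel_compatible : Prop :=
  (forall U, metric_open U -> measurable U) /\ separable_on.

Definition lipschitz_with (f : d.-tuple R -> R) (L : R) : Prop :=
  0 <= L /\ forall x y, E x -> E y -> `|f x - f y| <= L * dE x y.

Definition lipschitz_on_set (f : d.-tuple R -> R) : Prop :=
  exists L, lipschitz_with f L.

Definition Lip (f : d.-tuple R -> R) : R := inf [set L | lipschitz_with f L].

End metric_on_subset.

Section distributions.
Context {R : realType} {d : nat}.
Variable E : set (d.-tuple R).

(* P is a distribution on E with density rho: a probability measure on the
   whole of R^d that gives mass 1 to E. *)
Definition has_pdf (P : probability (d.-tuple R) R) (rho : d.-tuple R -> R) :
    Prop :=
  [/\ measurable_fun E rho, forall x, E x -> 0 <= rho x &
      forall A, measurable A ->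
        P A = (\int[leb d]_(x in E `&` A) (rho x)%:E)%E].

(* A real number: the integral of a nonnegative function which is +oo is sent
   to 0, so that 0 < evidence Phi rho says that the evidence is positive and
   finite. *)
Definition evidence (Phi rho : d.-tuple R -> R) : R :=
  \int[leb d]_(u in E) (Phi u * rho u).

Definition posterior_pdf (Phi rho : d.-tuple R -> R) (u : d.-tuple R) : R :=
  Phi u * rho u / evidence Phi rho.

Definition proportional_on (f g : d.-tuple R -> R) : Prop :=
  exists2 c, 0 < c & forall u, E u -> f u = c * g u.

Definition L1_norm (rho f : d.-tuple R -> R) : \bar R :=
  (\int[leb d]_(x in E) (`|f x| * rho x)%:E)%E.

Definition L2_norm (rho f : d.-tuple R -> R) : \bar R :=
  ((\int[leb d]_(x in E) (`|f x| ^+ 2 * rho x)%:E) `^ 2^-1)%E.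

Variable dE : d.-tuple R -> d.-tuple R -> R.

Definition Wnorm (q : R) (rho : d.-tuple R -> R) : \bar R :=
  ereal_inf [set ((\int[leb d]_(x in E) (dE x x0 `^ q * rho x)%:E) `^ q^-1)%E
            | x0 in E].

(* Couplings are arbitrary joint distributions: they need not have a density
   on R^d x R^d even when both marginals have one. *)
Definition coupling (P1 P2 : probability (d.-tuple R) R)
    (gamma : probability (d.-tuple R * d.-tuple R)%type R) : Prop :=
  forall A, measurable A ->
    gamma (A `*` setT) = P1 A /\ gamma (setT `*` A) = P2 A.

Definition W1 (P1 P2 : probability (d.-tuple R) R) : \bar R :=
  ereal_inf [set (\int[gamma]_(z in E `*` E) (dE z.1 z.2)%:E)%E
            | gamma in coupling P1 P2].

End distributions.

(* Main.v *)
Require Import Defs.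
From HB Require Import structures.
From mathcomp Require Import all_boot all_order all_algebra.
From mathcomp Require Import all_classical all_reals all_analysis.
From mathcomp Require Import measurable_realfun ring lra.

Set Implicit Arguments.
Unset Strict Implicit.
Unset Printing Implicit Defensive.

Import Order.TTheory GRing.Theory Num.Theory.
Import numFieldNormedType.Exports.
Local Open Scope classical_set_scope.
Local Open Scope ring_scope.

(** The bound would be quick to guess from Kantorovich duality: test the difference
    of the posteriors against a 1-Lipschitz function. Since the distance is an
    infimum over couplings, the proof builds the couplings that this argument
    suggests, and no duality is used.

    Write [Phi], [Psi] for the real and generated likelihoods, [Pr], [Pg] for the
    priors, [Qr], [Qg] for the evidences and [Q] for the mean of [Phi] under [Pg].
    From the real posterior one first reaches an intermediate probability, with
    density [r * Phi + (1 - r * Q) * Psi / Qg] with respect to [Pg], where [r] is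
    the inverse of [max Qr Q]. A coupling [gamma] of the priors provides the
    plan: the weight [r * min (Phi x) (Phi y)] follows [gamma], and the mass which
    is not covered, at most [r * Lip Phi] times the cost of [gamma], moves by at
    most [D] ([reweight_coupling]). This costs [(1 + D * Lip Phi) / Qr] times the
    cost of [gamma].

    The intermediate density exceeds that of the generated posterior by
    [r * (Phi - k * Psi)] with [k = Q / Qg], a function of mean 0. Its positive
    part is sent to its negative part through a hub [x0] ([change_target]), at the
    cost [r * \int c x x0 * |Phi - k * Psi|]. Writing
    [Phi - k * Psi = k * (Phi - Psi - (Q - Qg)) + (1 - k) * (Phi - Q)], the first
    term gives the L2 estimate, since centering does not increase the L2 norm and
    [r * k <= 1 / Qg]; the second one gives the L1 estimate, since
    [|1 - k| <= \int |Phi - Psi| / Qg] and [r <= 1 / Qr] ([likelihood_shift]).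

    The L1 and L2 moments of the generated prior are infima over different
    centers [a] and [b]. A hub that suits both exists ([common_center]): [a] or
    [b], at distance at most [2 * \int c x a] from [a]. This extra distance is
    absorbed by the mean deviation of [Phi], which is at most [1 / 2] because
    [Phi] takes values in [0, 1] ([mean_deviation_le_half]); the second term
    therefore costs at most the factor [1 + D * Lip Phi].

    Likelihood differences reduce to differences of the exponents because
    [expR (- x)] is Lipschitz with the constant [max Phi Psi] between the values
    at hand ([expRN_lipschitz]). *)

(** * Measures given by a density *)

Section densities.
Local Open Scope ereal_scope.
Context d (T : measurableType d) (R : realType).
Import HBNNSimple.

(** Both sides agree on indicators, hence on simple functions, and both pass to
    the monotone limit along a simple approximation of [f]. *)
Lemma integral_density (m m' : {measure set T -> \bar R}) (w f : T -> R) :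
  (forall x, 0 <= w x)%R -> measurable_fun setT w ->
  (forall A, measurable A -> m' A = \int[m]_(x in A) (w x)%:E) ->
  (forall x, 0 <= f x)%R -> measurable_fun setT f ->
  \int[m']_x (f x)%:E = \int[m]_x (f x * w x)%:E.
Proof.
move=> w0 mw m'E f0 mf.
have mF : measurable_fun setT (fun x => (f x)%:E : \bar R) by exact/measurable_EFinP.
pose h := nnsfun_approx measurableT mF.
have hcvg x : (EFin \o h n) x @[n --> \oo] --> (f x)%:E.
  by apply: cvg_nnsfun_approx => // y _; rewrite lee_fin.
transitivity (limn (fun n => \int[m']_x (h n x)%:E)).
  rewrite -monotone_convergence//.
  - by apply: eq_integral => x _; apply/esym/cvg_lim => //; exact: hcvg.
  - by move=> n; exact/measurable_EFinP/measurable_funP.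
  - by move=> n x _; rewrite lee_fin.
  - by move=> x _ a b ab; rewrite lee_fin; exact/lefP/nd_nnsfun_approx.
rewrite [RHS](_ : _ = limn (fun n => \int[m]_x (h n x * w x)%:E)); last first.
  rewrite -monotone_convergence//.
  - apply: eq_integral => x _; apply/esym/cvg_lim => //.
    under eq_fun do rewrite EFinM.
    by rewrite EFinM; apply: cvgeZr => //; exact: hcvg.
  - move=> n; apply/measurable_EFinP/measurable_funM => //.
  - by move=> n x _; rewrite lee_fin mulr_ge0.
  - move=> x _ a b ab; rewrite lee_fin ler_wpM2r//.
    exact/lefP/nd_nnsfun_approx.
congr (limn _); apply/funext => n.
transitivity (\int[m']_x
    (\sum_(y \in range (h n)) (y * \1_(h n @^-1` [set y]) x)%:E)).
  by apply: eq_integral => x _; rewrite /= fimfunE -fsumEFin.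
have mind r : measurable_fun setT (fun x => (r * \1_(h n @^-1` [set r]) x)%:E).
  by apply/measurable_EFinP; exact: measurable_funM.
rewrite ge0_integral_fsum//; last by move=> r x _; exact: nnfun_muleindic_ge0.
transitivity (\int[m]_x (\sum_(y \in range (h n))
    (y * \1_(h n @^-1` [set y]) x)%:E * (w x)%:E)); last first.
  apply: eq_integral => x _; rewrite -ge0_mule_fsuml; last first.
    by move=> y; exact: nnfun_muleindic_ge0.
  by rewrite fsumEFin// -(fimfunE _ x).
rewrite ge0_integral_fsum//; last 2 first.
  - by move=> y; apply: emeasurable_funM => //; exact/measurable_EFinP.
  - by move=> y x _; rewrite mule_ge0 ?lee_fin// -lee_fin nnfun_muleindic_ge0.
apply: eq_fsbigr => r rhn.
have r0 : (0 <= r)%R by move: rhn; rewrite inE => -[t _ <-].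
under eq_integral do rewrite EFinM.
rewrite integralZl_indic_nnsfun//.
under [RHS]eq_integral do rewrite EFinM -muleA.
rewrite ge0_integralZl//.
- rewrite integral_indic// setIT; congr (_ * _).
  rewrite m'E// integral_mkcond; apply: eq_integral => x _.
  by rewrite epatch_indic muleC.
- by apply: emeasurable_funM => //; exact/measurable_EFinP.
- by move=> x _; rewrite mule_ge0// lee_fin.
Qed.

(** Transport plans are cut into pieces by multiplying them by a density on the
    product space; [phi] then projects the mass left over onto one factor. *)
Lemma exists_pushed_density d' (X : measurableType d')
    (m : {measure set X -> \bar R}) (phi : X -> T) (w : X -> R) :
  measurable_fun setT phi ->
  (forall x, 0 <= w x)%R -> measurable_fun setT w ->
  (\int[m]_x (w x)%:E < +oo) ->
  exists m' : {finite_measure set T -> \bar R},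
    forall A, measurable A -> m' A = \int[m]_(x in phi @^-1` A) (w x)%:E.
Proof.
move=> mphi w0 mw wfin.
have mpre A : measurable A -> measurable (phi @^-1` A).
  by move=> mA; rewrite -[X in measurable X]setTI; exact: mphi.
pose m' A := \int[m]_(x in phi @^-1` A) (w x)%:E.
have m'0 : m' set0 = 0 by rewrite /m' preimage_set0 integral_set0.
have m'ge0 A : 0 <= m' A by apply: integral_ge0 => x _; rewrite lee_fin.
have m'sigma : semi_sigma_additive m'.
  move=> F mF tF mUF; rewrite /m' preimage_bigcup ge0_integral_bigcup//.
  - by apply: is_cvg_nneseries => n _ _; exact: m'ge0.
  - by move=> k; exact: mpre.
  - by apply/measurable_EFinP; exact: measurable_funTS.
  - by move=> x _; rewrite lee_fin.
  - apply/trivIsetP => i j _ _ ij; rewrite -preimage_setI.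
    by move/trivIsetP : tF => /(_ _ _ Logic.I Logic.I ij) ->; rewrite preimage_set0.
pose mx := isMeasure.Build _ _ _ m' m'0 m'ge0 m'sigma.
pose M : {measure set T -> \bar R} := HB.pack m' mx.
have Mfin : fin_num_fun M.
  move=> A mA; rewrite ge0_fin_numE; last exact: m'ge0.
  apply: le_lt_trans wfin; apply: ge0_subset_integral => //.
  - exact: mpre.
  - exact/measurable_EFinP.
  - by move=> x _; rewrite lee_fin.
pose fx := Measure_isFinite.Build _ _ _ M Mfin.
pose M' : {finite_measure set T -> \bar R} := HB.pack (m' : set T -> \bar R) mx fx.
by exists M'.
Qed.

Lemma exists_probability (m : {measure set T -> \bar R}) : m setT = 1 ->
  exists P : probability T R, forall A, P A = m A.
Proof.
move=> m1.
(* A measure of mass 1 is its own normalisation; the Dirac mass is the default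
   value that normalisation takes at null measures. *)
exists (mnormalize m (dirac point)) => A.
rewrite -[LHS]/((if (m setT == 0) || (m setT == +oo) then fun U => dirac point U
  else fun U => m U * (fine (m setT))^-1%:E) A).
by rewrite m1 onee_eq0/= invr1 mule1.
Qed.

End densities.

Lemma integral_pushed_density d d' (T : measurableType d)
    (X : measurableType d') (R : realType) (m : {measure set X -> \bar R})
    (m' : {measure set T -> \bar R}) (phi : X -> T) (w : X -> R) (f : T -> R) :
  measurable_fun setT phi ->
  (forall x, 0 <= w x) -> measurable_fun setT w ->
  (\int[m]_x (w x)%:E < +oo)%E ->
  (forall A, measurable A -> m' A = \int[m]_(x in phi @^-1` A) (w x)%:E)%E ->
  (forall x, 0 <= f x) -> measurable_fun setT f ->
  (\int[m']_x (f x)%:E = \int[m]_x (f (phi x) * w x)%:E)%E.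
Proof.
move=> mphi w0 mw wfin m'E f0 mf.
have [dens densE] := exists_pushed_density (@measurable_id _ _ setT) w0 mw wfin.
have mfphi : measurable_fun setT (f \o phi) by exact: measurableT_comp.
rewrite -(integral_density w0 mw densE (f := f \o phi))//; last first.
  by move=> x; exact: f0.
rewrite -[RHS](@ge0_integral_pushforward _ _ _ _ _ _ mphi dens setT
  (fun x => (f x)%:E))//.
- apply: eq_measure_integral => A mA _; rewrite m'E//.
  rewrite -[RHS]/(dens (phi @^-1` A)) densE//.
  by rewrite -[X in measurable X]setTI; exact: mphi.
- exact/measurable_EFinP.
- by move=> x _; rewrite lee_fin.
Qed.

(** * Integrals of nonnegative real functions *)

Section nonnegative_integrals.
Local Open Scope ereal_scope.
Context d (T : measurableType d) (R : realType) (m : {measure set T -> \bar R}).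
Implicit Types f g u v : T -> R.

Lemma integral_setE (A : set T) f :
  \int[m]_(x in A) (f x)%:E = \int[m]_x (f x * \1_A x)%:E.
Proof.
rewrite integral_mkcond; apply: eq_integral => x _.
by rewrite epatch_indic/= EFinM.
Qed.

Lemma ge0_integralD_EFin f g :
  (forall x, 0 <= f x)%R -> measurable_fun setT f ->
  (forall x, 0 <= g x)%R -> measurable_fun setT g ->
  \int[m]_x (f x + g x)%:E = \int[m]_x (f x)%:E + \int[m]_x (g x)%:E.
Proof.
move=> f0 mf g0 mg; under eq_integral do rewrite EFinD.
rewrite ge0_integralD//; try exact/measurable_EFinP.
- by move=> x _; rewrite lee_fin.
- by move=> x _; rewrite lee_fin.
Qed.

Lemma ge0_le_integral_EFin f g :
  (forall x, 0 <= f x)%R -> measurable_fun setT f -> measurable_fun setT g ->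
  (forall x, f x <= g x)%R ->
  \int[m]_x (f x)%:E <= \int[m]_x (g x)%:E.
Proof.
move=> f0 mf mg fg; apply: ge0_le_integral => //; try exact/measurable_EFinP.
- by move=> x _; rewrite lee_fin.
- by move=> x _; rewrite lee_fin.
Qed.

Lemma measurable_ratio u v : (forall x, 0 <= u x)%R ->
  measurable_fun setT u -> measurable_fun setT v ->
  measurable_fun setT (fun x => v x / u x)%R.
Proof.
move=> u0 mu mv.
(* For a nonnegative real, also for 0, the inverse is the power -1. *)
under eq_fun do rewrite -powR_inv1//.
apply: measurable_funM => //.
exact: (measurableT_comp (@measurable_powR R (-1)%R) mu).
Qed.

End nonnegative_integrals.

(** * Couplings and their completion *)

Section couplings.
Local Open Scope ereal_scope.
Context d (T : measurableType d) (R : realType).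

Definition couples (mu nu : probability T R)
    (gamma : probability (T * T)%type R) : Prop :=
  forall A, measurable A ->
    gamma (A `*` setT) = mu A /\ gamma (setT `*` A) = nu A.

Lemma integral_couples_fst (mu nu : probability T R) gamma (f : T -> R) :
  couples mu nu gamma -> (forall x, 0 <= f x)%R -> measurable_fun setT f ->
  \int[gamma]_z (f z.1)%:E = \int[mu]_x (f x)%:E.
Proof.
move=> g f0 mf.
rewrite -[LHS](@ge0_integral_pushforward _ _ _ _ _ _ measurable_fst gamma setT
  (fun x => (f x)%:E))//.
- apply: eq_measure_integral => A mA _.
  transitivity (gamma (A `*` setT)); last exact: (g _ mA).1.
  rewrite -[LHS]/(gamma (fst @^-1` A)); congr (gamma _).
  by apply/seteqP; split => -[x y] //= [].
- exact/measurable_EFinP.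
- by move=> x _; rewrite lee_fin.
Qed.

Lemma integral_couples_snd (mu nu : probability T R) gamma (f : T -> R) :
  couples mu nu gamma -> (forall x, 0 <= f x)%R -> measurable_fun setT f ->
  \int[gamma]_z (f z.2)%:E = \int[nu]_x (f x)%:E.
Proof.
move=> g f0 mf.
rewrite -[LHS](@ge0_integral_pushforward _ _ _ _ _ _ measurable_snd gamma setT
  (fun x => (f x)%:E))//.
- apply: eq_measure_integral => A mA _.
  transitivity (gamma (setT `*` A)); last exact: (g _ mA).2.
  rewrite -[LHS]/(gamma (snd @^-1` A)); congr (gamma _).
  by apply/seteqP; split => -[x y] //= [].
- exact/measurable_EFinP.
- by move=> x _; rewrite lee_fin.
Qed.

(** A partial transport plan [kappa] leaves the masses [alpha] and [beta] of the
    two marginals unmatched. They have equal total mass, so that their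
    normalised product matches them; the splitting of the cost [c] over the two
    variables makes the cost of this product explicit. *)
Lemma complete_coupling (mu nu : probability T R)
    (kappa : {measure set (T * T) -> \bar R})
    (alpha beta : {finite_measure set T -> \bar R})
    (c : T * T -> R) (a b : T -> R) :
  (forall A, measurable A -> kappa (A `*` setT) + alpha A = mu A) ->
  (forall A, measurable A -> kappa (setT `*` A) + beta A = nu A) ->
  (forall z, 0 <= c z)%R -> measurable_fun setT c ->
  (forall x, 0 <= a x)%R -> measurable_fun setT a ->
  (forall x, 0 <= b x)%R -> measurable_fun setT b ->
  (forall x y, c (x, y) <= a x + b y)%R ->
  exists2 gamma, couples mu nu gamma &
    \int[gamma]_z (c z)%:E <= \int[kappa]_z (c z)%:E +
      (\int[alpha]_x (a x)%:E + \int[beta]_x (b x)%:E).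
Proof.
move=> kmu knu c0 mc a0 ma b0 mb cab.
have ka1 : kappa setT + alpha setT = 1.
  by rewrite -setXTT kmu// probability_setT.
have kb1 : kappa setT + beta setT = 1.
  by rewrite -setXTT knu// probability_setT.
have kfin : kappa setT \is a fin_num.
  rewrite ge0_fin_numE//; apply: (@le_lt_trans _ _ 1); last exact: ltry.
  by rewrite -ka1 leeDl.
have ab : beta setT = alpha setT.
  by rewrite -[LHS](addeK _ kfin) -[RHS](addeK _ kfin) ![_ + kappa _]addeC kb1 ka1.
(* Without any mass left over, the partial plan is already a coupling. *)
have [alpha0|alphaN0] := eqVneq (alpha setT) 0.
  have kapE A : measurable A -> kappa (A `*` setT) = mu A.
    move=> mA; rewrite -kmu// (_ : alpha A = 0) ?adde0//.
    by apply/eqP; rewrite eq_le measure_ge0 andbT -alpha0 le_measure ?inE.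
  have kapE' A : measurable A -> kappa (setT `*` A) = nu A.
    move=> mA; rewrite -knu// (_ : beta A = 0) ?adde0//.
    by apply/eqP; rewrite eq_le measure_ge0 andbT -alpha0 -ab le_measure ?inE.
  have [|gamma gE] := @exists_probability _ _ _ kappa.
    by rewrite -setXTT kapE// probability_setT.
  exists gamma; first by move=> A mA; rewrite !gE; split; [exact: kapE|exact: kapE'].
  rewrite (eq_measure_integral kappa); last by move=> A mA _; exact: gE.
  by rewrite leeDl// adde_ge0// integral_ge0// => x _; rewrite lee_fin.
have afin : alpha setT \is a fin_num by rewrite fin_num_measure.
pose m := fine (alpha setT).
have m0 : (0 < m)%R by rewrite fine_gt0// lt0e alphaN0 measure_ge0/= -ge0_fin_numE.
have mi0 : (0 <= m^-1)%R by rewrite invr_ge0 ltW.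
pose betah : {finite_measure set T -> \bar R} := mscale (NngNum mi0) beta.
have bT : betah setT = 1.
  rewrite /betah /= /mscale/= ab -(fineK afin) -EFinM -/m mulVf//.
  by rewrite gt_eqF.
pose g : {measure set (T * T) -> \bar R} := measure_add kappa (alpha \x betah).
have gE (A : set (T * T)) : g A = kappa A + (alpha \x betah) A by exact: measure_addE.
have gmu A : measurable A -> g (A `*` setT) = mu A.
  move=> mA; rewrite gE product_measure1E// -kmu//.
  by rewrite [X in _ * X]bT mule1.
have gnu A : measurable A -> g (setT `*` A) = nu A.
  move=> mA; rewrite gE product_measure1E// -knu//; congr (_ + _).
  rewrite /betah /= /mscale/= -(fineK afin) -/m muleA -EFinM mulfV ?mul1e//.
  by rewrite gt_eqF.
have [|gamma gammaE] := @exists_probability _ _ _ g.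
  by rewrite -setXTT gmu// probability_setT.
exists gamma; first by move=> A mA; rewrite !gammaE; split; [exact: gmu|exact: gnu].
rewrite (eq_measure_integral g); last by move=> A mA _; exact: gammaE.
have mcE : measurable_fun setT (fun z => (c z)%:E) by exact/measurable_EFinP.
have maE : measurable_fun setT (fun z => (a z)%:E) by exact/measurable_EFinP.
have mbE : measurable_fun setT (fun z => (b z)%:E) by exact/measurable_EFinP.
have ma1 : measurable_fun setT (fun z : T * T => (a z.1)%:E).
  exact: (measurableT_comp maE measurable_fst).
have mb2 : measurable_fun setT (fun z : T * T => (b z.2)%:E).
  exact: (measurableT_comp mbE measurable_snd).
rewrite ge0_integral_measure_add//; last by move=> z _; rewrite lee_fin.
rewrite leeD2l//.
apply: (@le_trans _ _ (\int[alpha \x betah]_z ((a z.1)%:E + (b z.2)%:E))).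
  apply: ge0_le_integral => //.
  - by move=> z _; rewrite lee_fin.
  - exact: emeasurable_funD.
  - by move=> [x y] _; rewrite -EFinD lee_fin.
rewrite ge0_integralD//; last 2 first.
- by move=> z _; rewrite lee_fin.
- by move=> z _; rewrite lee_fin.
rewrite leeD//.
  rewrite fubini_tonelli1//=; last by move=> z; rewrite lee_fin.
  rewrite /fubini_F/=; apply: ge0_le_integral => //.
  - by move=> x _; apply: integral_ge0 => y _; rewrite lee_fin.
  - apply: (@measurable_fun_fubini_tonelli_F _ _ _ _ _ betah
      (fun z => (a z.1)%:E)) => // z.
    by rewrite lee_fin.
  - by move=> x _; rewrite integral_cst//= [X in _ * X]bT mule1.
rewrite fubini_tonelli2//=; last by move=> z; rewrite lee_fin.
rewrite /fubini_G/=.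
under eq_integral do rewrite integral_cst//=.
rewrite ge0_integralZr//; last by move=> x _; rewrite lee_fin.
rewrite ge0_integral_mscale//; last by move=> x _; rewrite lee_fin.
rewrite /= -(fineK afin) -/m muleAC -EFinM mulVf ?gt_eqF// mul1e.
exact: lexx.
Qed.

End couplings.

(** * Two modifications of a coupling *)

Section transport_steps.
Local Open Scope ereal_scope.
Context d (T : measurableType d) (R : realType).

Variable c : T * T -> R.
Hypothesis c_ge0 : forall z, (0 <= c z)%R.
Hypothesis mc : measurable_fun setT c.
Hypothesis c_sym : forall x y, c (x, y) = c (y, x).
Hypothesis c_triangle : forall x y z, (c (x, z) <= c (x, y) + c (y, z))%R.

Lemma measurable_section x0 : measurable_fun setT (fun x => c (x, x0)).
Proof.
by apply: (measurableT_comp mc); exact: pair2_measurable.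
Qed.

(** A transport plan towards [tau] becomes one towards [nu] by leaving in place
    the common part [min u v] and sending the surplus of [tau] to the deficit
    of [nu] through the hub [x0]. The mass to be rerouted starts at the first
    coordinate [x] of the plan, but it may be thought of at its second
    coordinate [z], since [c x x0 <= c x z + c z x0] and the first term
    completes the cost of the original plan. This is the triangle inequality
    for transport costs without any gluing of plans: both measures have a
    density, so the second plan is an explicit kernel. *)
Lemma change_target (mu tau nu : probability T R)
    (Gamma : probability (T * T)%type R) (P : {measure set T -> \bar R})
    (u v : T -> R) (x0 : T) :
  couples mu tau Gamma ->
  (forall x, 0 <= u x)%R -> measurable_fun setT u ->
  (forall x, 0 <= v x)%R -> measurable_fun setT v ->
  (forall A, measurable A -> tau A = \int[P]_(x in A) (u x)%:E) ->
  (forall A, measurable A -> nu A = \int[P]_(x in A) (v x)%:E) ->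
  exists2 gamma, couples mu nu gamma &
    \int[gamma]_z (c z)%:E <= \int[Gamma]_z (c z)%:E +
      \int[P]_z (c (z, x0) * `|u z - v z|)%:E.
Proof.
move=> G u0 mu_ v0 mv tauE nuE.
(* The proportion of the mass of [tau] at [z] that [nu] can receive. Where [u]
   vanishes the quotient is 0, which is harmless since [tau] ignores this set. *)
pose p z := Num.min 1%R (v z / u z)%R.
pose q z := (1 - p z)%R.
have mp : measurable_fun setT p.
  by apply: measurable_minr => //; exact: measurable_ratio.
have mq : measurable_fun setT q by exact: measurable_funB.
have p0 z : (0 <= p z)%R by rewrite le_min ler01 divr_ge0.
have p1 z : (p z <= 1)%R by rewrite ge_min lexx.
have q0 z : (0 <= q z)%R by rewrite subr_ge0.
have q1 z : (q z <= 1)%R by rewrite lerBlDr lerDl.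
have pq z : (p z + q z = 1)%R by rewrite /q addrC subrK.
have pu z : (p z * u z = Num.min (u z) (v z))%R.
  have [uz0|uzN0] := eqVneq (u z) 0%R.
    by rewrite uz0 mulr0 min_l.
  rewrite minr_pMl// mul1r divfK//.
have qu z : (q z * u z = Num.max (u z - v z) 0)%R.
  rewrite mulrBl mul1r pu; case: (leP (u z) (v z)) => uv.
    by rewrite subrr max_r// subr_le0.
  by rewrite max_l// subr_ge0 ltW.
have mp2 : measurable_fun setT (fun z : T * T => p z.2).
  exact: (measurableT_comp mp measurable_snd).
have mq2 : measurable_fun setT (fun z : T * T => q z.2).
  exact: (measurableT_comp mq measurable_snd).
have le1fin (f : T * T -> R) : measurable_fun setT f ->
    (forall z, 0 <= f z)%R -> (forall z, f z <= 1)%R ->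
    \int[Gamma]_z (f z)%:E < +oo.
  move=> mf f0 f1; apply: (@le_lt_trans _ _ (\int[Gamma]_z 1%:E)).
    exact: ge0_le_integral_EFin.
  by rewrite integral_cst//= mul1e probability_setT ltry.
pose w z := Num.max (v z - u z)%R 0%R.
have mw : measurable_fun setT w.
  by apply: measurable_maxr => //; exact: measurable_funB.
have w0 z : (0 <= w z)%R by rewrite le_max lexx orbT.
have wfin : \int[P]_z (w z)%:E < +oo.
  apply: (@le_lt_trans _ _ (\int[P]_z (v z)%:E)).
    by apply: ge0_le_integral_EFin => // z; rewrite ge_max v0 gerBl u0.
  by rewrite -nuE// probability_setT ltry.
have p2fin := le1fin _ mp2 (fun z => p0 z.2) (fun z => p1 z.2).
have q2fin := le1fin _ mq2 (fun z => q0 z.2) (fun z => q1 z.2).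
have [kappa' kE'] := exists_pushed_density (@measurable_id _ _ setT)
  (fun z => p0 z.2) mp2 p2fin.
pose kappa : {measure set (T * T) -> \bar R} := kappa'.
have kE A : measurable A -> kappa A = \int[Gamma]_(z in A) (p z.2)%:E.
  exact: kE'.
have [alpha aE] := exists_pushed_density (@measurable_fst _ _ T T)
  (fun z => q0 z.2) mq2 q2fin.
have [beta bE] := exists_pushed_density (@measurable_id _ _ setT) w0 mw wfin.
have mX := @measurable_section x0.
have [|||||||||gamma gmunu gcost] := @complete_coupling _ _ _ mu nu kappa alpha
    beta c (fun x => c (x, x0)) (fun x => c (x, x0)) => //.
- move=> A mA; rewrite kE; last exact: measurableX.
  rewrite aE// (_ : fst @^-1` A = A `*` setT); last first.
    by apply/seteqP; split => -[x y] //= [].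
  rewrite !(integral_setE _ (A `*` setT)).
  have mI : measurable_fun setT (\1_(A `*` [set: T]) : T * T -> R).
    by apply: measurable_indic; exact: measurableX.
  rewrite -ge0_integralD_EFin//; last 4 first.
  - by move=> x; rewrite mulr_ge0.
  - exact: measurable_funM.
  - by move=> x; rewrite mulr_ge0.
  - exact: measurable_funM.
  have [<- _] := G _ mA.
  under eq_integral do rewrite -mulrDl pq mul1r.
  by rewrite integral_indic// ?setIT//; exact: measurableX.
- move=> A mA; rewrite kE; last exact: measurableX.
  rewrite bE// preimage_id nuE// !(integral_setE _ A).
  have mI : measurable_fun setT (\1_A : T -> R) by exact: measurable_indic.
  transitivity (\int[P]_x (p x * \1_A x * u x)%:E
                 + \int[P]_x (w x * \1_A x)%:E).
    congr (_ + _).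
    rewrite -(integral_density u0 mu_ tauE (f := fun x => p x * \1_A x)%R)//.
    - rewrite -(integral_couples_snd (f := fun x => p x * \1_A x)%R G)//.
      + rewrite integral_setE; apply: eq_integral => -[x y] _.
        by rewrite !indicE/= in_setX/= in_setT.
      + by move=> x; rewrite mulr_ge0.
      + exact: measurable_funM.
    - by move=> x; rewrite mulr_ge0.
    - exact: measurable_funM.
  rewrite -ge0_integralD_EFin.
  + apply: eq_integral => x _; congr EFin.
    rewrite mulrAC -mulrDl pu /w; congr (_ * _)%R.
    case: (leP (u x) (v x)) => uv.
      by rewrite max_l ?subr_ge0// addrC subrK.
    by rewrite max_r ?addr0// subr_le0 ltW.
  + by move=> x; rewrite !mulr_ge0.
  + by apply: measurable_funM => //; exact: measurable_funM.
  + by move=> x; rewrite mulr_ge0.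
  + exact: measurable_funM.
- by move=> x y; rewrite [c (y, _)]c_sym.
exists gamma => //; apply: (le_trans gcost).
rewrite (integral_pushed_density _ (fun z => p0 z.2) mp2 p2fin kE)//.
rewrite (integral_pushed_density _ (fun z => q0 z.2) mq2 q2fin aE)//.
rewrite (integral_pushed_density _ w0 mw wfin bE)//=.
have mcp : measurable_fun setT (fun z => c z * p z.2)%R by exact: measurable_funM.
have mcq : measurable_fun setT (fun z => c z * q z.2)%R by exact: measurable_funM.
have mX1 : measurable_fun setT (fun z : T * T => c (z.1, x0)).
  exact: (measurableT_comp mX measurable_fst).
have mX2 : measurable_fun setT (fun z : T * T => c (z.2, x0)).
  exact: (measurableT_comp mX measurable_snd).
apply: (@le_trans _ _ (\int[Gamma]_z (c z * p z.2)%:E +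
   (\int[Gamma]_z (c z * q z.2)%:E + \int[Gamma]_z (c (z.2, x0) * q z.2)%:E
     + \int[P]_z (c (z, x0) * w z)%:E))).
  rewrite leeD2l// leeD2r//.
  rewrite -ge0_integralD_EFin//; last 3 first.
  - by move=> z; rewrite mulr_ge0.
  - by move=> z; rewrite mulr_ge0.
  - exact: measurable_funM.
  apply: ge0_le_integral_EFin.
  - by move=> z; rewrite mulr_ge0.
  - exact: measurable_funM.
  - by apply: measurable_funD => //; exact: measurable_funM.
  - by move=> [x z] /=; rewrite -mulrDl ler_wpM2r.
rewrite -addeA addeA leeD//.
  rewrite -ge0_integralD_EFin//; last 2 first.
  - by move=> z; rewrite mulr_ge0.
  - by move=> z; rewrite mulr_ge0.
  by under eq_integral do rewrite -mulrDr pq mulr1.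
rewrite (integral_couples_snd (f := fun z => c (z, x0) * q z)%R G); last 2 first.
- by move=> z; rewrite mulr_ge0.
- exact: measurable_funM.
rewrite (integral_density u0 mu_ tauE); last 2 first.
- by move=> z; rewrite mulr_ge0.
- exact: measurable_funM.
rewrite -ge0_integralD_EFin; last 4 first.
- by move=> z; rewrite !mulr_ge0.
- by apply: measurable_funM => //; exact: measurable_funM.
- by move=> z; rewrite mulr_ge0.
- exact: measurable_funM.
rewrite le_eqVlt; apply/orP; left; apply/eqP; apply: eq_integral => z _.
congr EFin; rewrite -mulrA qu -mulrDr; congr (_ * _)%R.
rewrite /w; case: (leP (u z) (v z)) => uv.
  by rewrite max_r ?subr_le0// max_l ?subr_ge0// add0r distrC ger0_norm ?subr_ge0.
by rewrite max_l ?subr_ge0 ?ltW// max_r ?subr_le0 ?ltW// addr0 gtr0_norm ?subr_gt0.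
Qed.

(** Reweighting both marginals of [gamma] by [Phi]. The common part
    [r * min (Phi x) (Phi y)] of the weights follows [gamma], and costs at most
    [r] times the cost of [gamma]. All the remaining mass is moved at the price
    [D]; the normalisation hypothesis on [r] says that this mass is at most
    [r * |Phi x - Phi y|] on average, hence [r * L] times the cost of [gamma].
    The target [tau] only has to dominate [r * Phi], so that any probability
    may fill up the mass that [r * Phi] lacks. *)
Lemma reweight_coupling (Pr Pg mu tau : probability T R)
    (gamma : probability (T * T)%type R) (Phi u : T -> R) (L D r s : R) :
  couples Pr Pg gamma ->
  measurable_fun setT Phi -> (forall x, 0 <= Phi x <= 1)%R ->
  (0 <= L)%R -> (forall x y, `|Phi x - Phi y| <= L * c (x, y))%R ->
  (forall z, c z <= D)%R -> (0 <= r <= s)%R ->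
  measurable_fun setT u -> (forall x, r * Phi x <= u x)%R ->
  (forall A, measurable A -> mu A = \int[Pr]_(x in A) (s * Phi x)%:E) ->
  (forall A, measurable A -> tau A = \int[Pg]_(x in A) (u x)%:E) ->
  (\int[Pr]_x (r * Phi x)%:E = 1 \/ \int[Pg]_x (r * Phi x)%:E = 1) ->
  exists2 Gamma, couples mu tau Gamma &
    \int[Gamma]_z (c z)%:E <= (r * (1 + D * L))%:E * \int[gamma]_z (c z)%:E.
Proof.
move=> g mPhi Phi01 L0 lip cD /andP[r0 rs] mu_ rPhiu muE tauE mass.
have Phi0 x : (0 <= Phi x)%R by case/andP: (Phi01 x).
have s0 : (0 <= s)%R := le_trans r0 rs.
have D0 : (0 <= D)%R := le_trans (c_ge0 point) (cD point).
have u0 x : (0 <= u x)%R by apply: le_trans (rPhiu x); rewrite mulr_ge0.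
pose k z := (r * Num.min (Phi z.1) (Phi z.2))%R.
have mP1 : measurable_fun setT (fun z : T * T => Phi z.1).
  exact: (measurableT_comp mPhi measurable_fst).
have mP2 : measurable_fun setT (fun z : T * T => Phi z.2).
  exact: (measurableT_comp mPhi measurable_snd).
have mu2 : measurable_fun setT (fun z : T * T => u z.2).
  exact: (measurableT_comp mu_ measurable_snd).
have mk : measurable_fun setT k.
  by apply: measurable_funM => //; exact: measurable_minr.
have k0 z : (0 <= k z)%R by rewrite mulr_ge0// le_min !Phi0.
have k1 z : (k z <= r * Phi z.1)%R by rewrite ler_wpM2l// ge_min lexx.
have k2 z : (k z <= r * Phi z.2)%R by rewrite ler_wpM2l// ge_min lexx orbT.
pose a z := (s * Phi z.1 - k z)%R.
pose b z := (u z.2 - k z)%R.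
have ma : measurable_fun setT a.
  by apply: measurable_funB => //; exact: measurable_funM.
have mb : measurable_fun setT b by exact: measurable_funB.
have a0 z : (0 <= a z)%R.
  by rewrite subr_ge0 (le_trans (k1 z))// ler_wpM2r.
have b0 z : (0 <= b z)%R by rewrite subr_ge0 (le_trans (k2 z)).
have sPhiT : \int[gamma]_z (s * Phi z.1)%:E = 1.
  rewrite (integral_couples_fst (f := fun x => s * Phi x)%R g).
  - by rewrite -muE// probability_setT.
  - by move=> x; rewrite mulr_ge0.
  - exact: measurable_funM.
have uT : \int[gamma]_z (u z.2)%:E = 1.
  rewrite (integral_couples_snd (f := u) g)// -tauE//.
  by rewrite probability_setT.
have ak1 : \int[gamma]_z (a z)%:E + \int[gamma]_z (k z)%:E = 1.
  rewrite -ge0_integralD_EFin// -sPhiT.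
  by apply: eq_integral => z _; rewrite subrK.
have bk1 : \int[gamma]_z (b z)%:E + \int[gamma]_z (k z)%:E = 1.
  rewrite -ge0_integralD_EFin// -uT.
  by apply: eq_integral => z _; rewrite subrK.
have I0 (h : T * T -> R) : (forall z, 0 <= h z)%R -> 0 <= \int[gamma]_z (h z)%:E.
  by move=> h0; apply: integral_ge0 => z _; rewrite lee_fin.
have afin : \int[gamma]_z (a z)%:E < +oo.
  by apply: (@le_lt_trans _ _ 1); [rewrite -ak1 leeDl// I0|exact: ltry].
have bfin : \int[gamma]_z (b z)%:E < +oo.
  by apply: (@le_lt_trans _ _ 1); [rewrite -bk1 leeDl// I0|exact: ltry].
have kfin : \int[gamma]_z (k z)%:E < +oo.
  by apply: (@le_lt_trans _ _ 1); [rewrite -bk1 leeDr// I0|exact: ltry].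
have [kappa' kE'] := exists_pushed_density (@measurable_id _ _ setT) k0 mk kfin.
pose kappa : {measure set (T * T) -> \bar R} := kappa'.
have kE A : measurable A -> kappa A = \int[gamma]_(z in A) (k z)%:E.
  exact: kE'.
have [alpha aE] := exists_pushed_density (@measurable_fst _ _ T T) a0 ma afin.
have [beta bE] := exists_pushed_density (@measurable_snd _ _ T T) b0 mb bfin.
have [||||||||| Gamma Gc Gcost] := @complete_coupling _ _ _ mu tau kappa alpha
    beta c (cst D) (cst 0%R) => //.
- move=> A mA; have mAT : measurable (A `*` [set: T]) by exact: measurableX.
  rewrite kE// aE// (_ : fst @^-1` A = A `*` setT); last first.
    by apply/seteqP; split => -[x y] //= [].
  rewrite !(integral_setE _ (A `*` setT)).
  have mI : measurable_fun setT (\1_(A `*` [set: T]) : T * T -> R).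
    exact: measurable_indic.
  have mIA : measurable_fun setT (\1_A : T -> R) by exact: measurable_indic.
  rewrite -ge0_integralD_EFin//; last 4 first.
  - by move=> z; rewrite mulr_ge0.
  - exact: measurable_funM.
  - by move=> z; rewrite mulr_ge0.
  - exact: measurable_funM.
  rewrite muE// (integral_setE _ A).
  rewrite -(integral_couples_fst (f := fun x => s * Phi x * \1_A x)%R g).
  + apply: eq_integral => -[x y] _; congr EFin.
    rewrite -mulrDl /a addrC subrK; congr (_ * _)%R.
    by rewrite !indicE/= in_setX/= in_setT andbT.
  + by move=> x; rewrite !mulr_ge0.
  + by apply: measurable_funM => //; exact: measurable_funM.
- move=> A mA; have mAT : measurable ([set: T] `*` A) by exact: measurableX.
  rewrite kE// bE// (_ : snd @^-1` A = setT `*` A); last first.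
    by apply/seteqP; split => -[x y] //= [].
  rewrite !(integral_setE _ (setT `*` A)).
  have mI : measurable_fun setT (\1_([set: T] `*` A) : T * T -> R).
    exact: measurable_indic.
  have mIA : measurable_fun setT (\1_A : T -> R) by exact: measurable_indic.
  rewrite -ge0_integralD_EFin//; last 4 first.
  - by move=> z; rewrite mulr_ge0.
  - exact: measurable_funM.
  - by move=> z; rewrite mulr_ge0.
  - exact: measurable_funM.
  rewrite tauE// (integral_setE _ A).
  rewrite -(integral_couples_snd (f := fun x => u x * \1_A x)%R g).
  + apply: eq_integral => -[x y] _; congr EFin.
    rewrite -mulrDl /b addrC subrK; congr (_ * _)%R.
    by rewrite !indicE/= in_setX/= in_setT.
  + by move=> x; rewrite mulr_ge0.
  + exact: measurable_funM.
- by move=> x y; rewrite addr0.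
exists Gamma => //; apply: (le_trans Gcost).
rewrite (integral_pushed_density _ k0 mk kfin kE)//.
rewrite (integral_pushed_density (f := cst D) _ a0 ma afin aE)//.
rewrite integral0 adde0/=.
(* The unmatched mass has total 1 minus that of [k], and 1 is the total of
   [r * Phi] in one of the two coordinates. *)
have aLc : \int[gamma]_z (a z)%:E <= \int[gamma]_z (r * L * c z)%:E.
  suff [h [h0 mh hle hk]] : exists h : T * T -> R, [/\ (forall z, 0 <= h z)%R,
      measurable_fun setT h, (forall z, h z <= r * L * c z)%R &
      \int[gamma]_z (h z)%:E + \int[gamma]_z (k z)%:E = 1].
    have -> : \int[gamma]_z (a z)%:E = \int[gamma]_z (h z)%:E.
      have kf : \int[gamma]_z (k z)%:E \is a fin_num by rewrite ge0_fin_numE// I0.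
      by rewrite -[LHS](addeK _ kf) ak1 -hk addeK.
    by apply: ge0_le_integral_EFin => //; exact: measurable_funM.
  have bnd z : (Num.max (Phi z.1) (Phi z.2) - Num.min (Phi z.1) (Phi z.2)
      <= L * c z)%R.
    case: z => x y /=; apply: le_trans (lip x y).
    by case: (leP (Phi x) (Phi y)) => _; rewrite ?ler_norm// distrC ler_norm.
  case: mass => mass.
    exists (fun z => r * Phi z.1 - k z)%R; split.
    + by move=> z; rewrite subr_ge0.
    + by apply: measurable_funB => //; exact: measurable_funM.
    + move=> z; rewrite /k -mulrBr -mulrA ler_wpM2l//.
      by apply: le_trans (bnd z); rewrite lerB// le_max lexx.
    + rewrite -ge0_integralD_EFin//; last 2 first.
      - by move=> z; rewrite subr_ge0.
      - by apply: measurable_funB => //; exact: measurable_funM.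
      rewrite -mass -(integral_couples_fst (f := fun x => r * Phi x)%R g).
      - by apply: eq_integral => z _; rewrite subrK.
      - by move=> x; rewrite mulr_ge0.
      - exact: measurable_funM.
  exists (fun z => r * Phi z.2 - k z)%R; split.
  + by move=> z; rewrite subr_ge0.
  + by apply: measurable_funB => //; exact: measurable_funM.
  + move=> z; rewrite /k -mulrBr -mulrA ler_wpM2l//.
    by apply: le_trans (bnd z); rewrite lerB// le_max lexx orbT.
  + rewrite -ge0_integralD_EFin//; last 2 first.
    - by move=> z; rewrite subr_ge0.
    - by apply: measurable_funB => //; exact: measurable_funM.
    rewrite -mass -(integral_couples_snd (f := fun x => r * Phi x)%R g).
    - by apply: eq_integral => z _; rewrite subrK.
    - by move=> x; rewrite mulr_ge0.
    - exact: measurable_funM.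
have cE0 z : 0 <= (c z)%:E by rewrite lee_fin.
have mcE : measurable_fun setT (fun z => (c z)%:E) by exact/measurable_EFinP.
rewrite mulrDr mulr1 EFinD ge0_muleDl ?lee_fin ?mulr_ge0//.
rewrite leeD//.
  rewrite -ge0_integralZl//.
  apply: ge0_le_integral => //.
  - by move=> z _; rewrite lee_fin mulr_ge0.
  - by apply/measurable_EFinP; exact: measurable_funM.
  - exact: measurable_funeM.
  - move=> z _; rewrite -EFinM lee_fin mulrC ler_wpM2r//.
    apply: (le_trans (k1 z)); rewrite ler_piMr//.
    by case/andP: (Phi01 z.1).
under eq_integral do rewrite EFinM.
rewrite ge0_integralZl//; last 2 first.
- exact/measurable_EFinP.
- by move=> z _; rewrite lee_fin.
rewrite mulrCA EFinM -muleA lee_wpmul2l ?lee_fin//.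
apply: (le_trans aLc).
under eq_integral do rewrite EFinM.
by rewrite ge0_integralZl// lee_fin mulr_ge0.
Qed.

End transport_steps.

(** * Means of bounded measurable functions *)

Section bounded_measurable.
Context d (T : measurableType d) (R : realType).
Implicit Types f g : T -> R.

Definition bounded_measurable f : Prop :=
  measurable_fun setT f /\ exists M, forall x, `|f x| <= M.

Lemma bounded_measurable_cst k : bounded_measurable (fun=> k).
Proof. by split => //; exists `|k|. Qed.

Lemma bounded_measurableD f g : bounded_measurable f -> bounded_measurable g ->
  bounded_measurable (fun x => f x + g x).
Proof.
move=> [mf [M fM]] [mg [N gN]]; split; first exact: measurable_funD.
by exists (M + N) => x; rewrite (le_trans (ler_normD _ _))// lerD.
Qed.

Lemma bounded_measurableM f g : bounded_measurable f -> bounded_measurable g ->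
  bounded_measurable (fun x => f x * g x).
Proof.
move=> [mf [M fM]] [mg [N gN]]; split; first exact: measurable_funM.
by exists (M * N) => x; rewrite normrM ler_pM.
Qed.

Lemma bounded_measurableB f g : bounded_measurable f -> bounded_measurable g ->
  bounded_measurable (fun x => f x - g x).
Proof.
move=> [mf [M fM]] [mg [N gN]]; split; first exact: measurable_funB.
by exists (M + N) => x; rewrite (le_trans (ler_normB _ _))// lerD.
Qed.

Lemma bounded_measurable_norm f : bounded_measurable f ->
  bounded_measurable (fun x => `|f x|).
Proof.
move=> [mf [M fM]]; split; first exact: measurableT_comp.
by exists M => x; rewrite normr_id.
Qed.

End bounded_measurable.

Local Ltac bounded := repeat first [done | exact: bounded_measurable_cst
  | apply: bounded_measurableB | apply: bounded_measurableD
  | apply: bounded_measurableM | apply: bounded_measurable_norm].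

Section means.
Context d (T : measurableType d) (R : realType) (P : probability T R).
Implicit Types f g : T -> R.
Local Notation E f := (\int[P]_x f x).

Lemma bounded_measurable_integrable f : bounded_measurable f ->
  P.-integrable setT (EFin \o f).
Proof.
move=> [mf [M fM]]; apply: measurable_bounded_integrable => //.
  by rewrite -ge0_fin_numE// fin_num_measure.
exists M; split; first exact: num_real.
by move=> N MN x _ /=; rewrite (le_trans (fM x))// ltW.
Qed.

Lemma bounded_measurable_EFin f : bounded_measurable f ->
  (\int[P]_x (f x)%:E)%E = (E f)%:E.
Proof.
move=> bf; rewrite /Rintegral fineK//.
by apply: integrable_fin_num => //; exact: bounded_measurable_integrable.
Qed.

Lemma mean_cst k : E (fun=> k) = k.
Proof.
apply: EFin_inj; rewrite -bounded_measurable_EFin; last exact: bounded_measurable_cst.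
by rewrite integral_cst//= probability_setT mule1.
Qed.

Lemma meanD f g : bounded_measurable f -> bounded_measurable g ->
  E (fun x => f x + g x) = E f + E g.
Proof. by move=> bf bg; rewrite RintegralD//; exact: bounded_measurable_integrable. Qed.

Lemma meanB f g : bounded_measurable f -> bounded_measurable g ->
  E (fun x => f x - g x) = E f - E g.
Proof. by move=> bf bg; rewrite RintegralB//; exact: bounded_measurable_integrable. Qed.

Lemma meanZ k f : bounded_measurable f -> E (fun x => k * f x) = k * E f.
Proof. by move=> bf; rewrite RintegralZl//; exact: bounded_measurable_integrable. Qed.

Lemma mean_le f g : bounded_measurable f -> bounded_measurable g ->
  (forall x, f x <= g x) -> E f <= E g.
Proof.
by move=> bf bg fg; apply: le_Rintegral => //; exact: bounded_measurable_integrable.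
Qed.

Lemma mean_ge0 f : (forall x, 0 <= f x) -> 0 <= E f.
Proof. by move=> f0; exact: Rintegral_ge0. Qed.

Lemma normr_mean_le f : bounded_measurable f -> `|E f| <= E (fun x => `|f x|).
Proof.
by move=> bf; apply: le_normr_Rintegral => //; exact: bounded_measurable_integrable.
Qed.

(** The mean of [(f - t * g) ^+ 2] is a nonnegative quadratic polynomial in [t]. *)
Lemma cauchy_schwarz f g : bounded_measurable f -> bounded_measurable g ->
  (E (fun x => f x * g x)) ^+ 2 <=
  E (fun x => f x ^+ 2) * E (fun x => g x ^+ 2).
Proof.
move=> bf bg.
set A := E (fun x => f x ^+ 2); set B := E (fun x => f x * g x).
set C := E (fun x => g x ^+ 2).
have quad t : 0 <= A - 2 * t * B + t ^+ 2 * C.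
  have -> : A - 2 * t * B + t ^+ 2 * C = E (fun x => (f x - t * g x) ^+ 2).
    rewrite (_ : (fun x => (f x - t * g x) ^+ 2) = (fun x =>
      f x * f x - (2 * t) * (f x * g x) + t ^+ 2 * (g x * g x))); last first.
      by apply/funext => x; ring.
    by rewrite meanD ?meanB ?meanZ//; bounded.
  by apply: mean_ge0 => x; exact: sqr_ge0.
have C0 : 0 <= C by apply: mean_ge0 => x; exact: sqr_ge0.
have [C00|CN0] := eqVneq C 0.
  have [->|BN0] := eqVneq B 0; first by rewrite expr0n/= C00 mulr0.
  have := quad ((A + 1) / (2 * B)).
  have -> : 2 * ((A + 1) / (2 * B)) * B = A + 1 by field.
  by rewrite C00; lra.
have Cp : 0 < C by rewrite lt0r CN0.
have := quad (B / C).
have -> : A - 2 * (B / C) * B + (B / C) ^+ 2 * C = (A * C - B ^+ 2) / C by field.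
by rewrite pmulr_lge0 ?invr_gt0// subr_ge0.
Qed.

Lemma mean_mul_le f g n m : bounded_measurable f -> bounded_measurable g ->
  0 <= n -> 0 <= m ->
  E (fun x => f x ^+ 2) <= n ^+ 2 -> E (fun x => g x ^+ 2) <= m ^+ 2 ->
  E (fun x => f x * g x) <= n * m.
Proof.
move=> bf bg n0 m0 fn gm; apply: le_trans (ler_norm _) _.
rewrite -(ger0_norm (mulr_ge0 n0 m0)) -ler_sqr ?nnegrE//.
rewrite !real_normK ?num_real// (le_trans (cauchy_schwarz bf bg))// exprMn.
by apply: ler_pM => //; apply: mean_ge0 => x; exact: sqr_ge0.
Qed.

Lemma variance_le f : bounded_measurable f ->
  E (fun x => (f x - E f) ^+ 2) <= E (fun x => f x ^+ 2).
Proof.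
move=> bf; set m := E f.
have -> : E (fun x => (f x - m) ^+ 2) = E (fun x => f x ^+ 2) - m ^+ 2.
  rewrite (_ : (fun x => (f x - m) ^+ 2) = (fun x =>
    f x * f x - 2 * m * f x + m ^+ 2)); last by apply/funext => x; ring.
  by rewrite meanD ?meanB ?meanZ ?mean_cst; try bounded; rewrite -/m; ring.
by rewrite gerBl sqr_ge0.
Qed.

(** On [0, 1] the convex function [fun y => `|y - m|] lies below its chord
    [(1 - 2 * m) * y + m], whose mean is [2 * m * (1 - m) <= 1 / 2] when [m] is
    the mean of [f]. *)
Lemma mean_deviation_le_half f : measurable_fun setT f ->
  (forall x, 0 <= f x <= 1) -> E (fun x => `|f x - E f|) <= 2^-1.
Proof.
move=> mf f01.
have bf : bounded_measurable f.
  by split => //; exists 1 => x; rewrite ger0_norm; case/andP: (f01 x).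
set m := E f.
have m0 : 0 <= m by apply: mean_ge0 => x; case/andP: (f01 x).
have m1 : m <= 1.
  rewrite -[leRHS]mean_cst; apply: mean_le => //; first exact: bounded_measurable_cst.
  by move=> x; case/andP: (f01 x).
apply: (@le_trans _ _ (E (fun x => (1 - 2 * m) * f x + m))).
  apply: mean_le => [||x].
  - by bounded.
  - by bounded.
  - case/andP: (f01 x) => fx0 fx1; rewrite ler_norml; apply/andP; split; nra.
rewrite meanD ?meanZ ?mean_cst; try bounded.
rewrite -/m; have := sqr_ge0 (2 * m - 1); nra.
Qed.

End means.

(** * Transport between posteriors *)

Section posterior_stability.
Context d (T : measurableType d) (R : realType).
Variable c : T * T -> R.
Hypothesis c_ge0 : forall z, (0 <= c z)%R.
Hypothesis mc : measurable_fun setT c.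
Hypothesis c_sym : forall x y, c (x, y) = c (y, x).
Hypothesis c_triangle : forall x y z, (c (x, z) <= c (x, y) + c (y, z))%R.
Variable D : R.
Hypothesis cD : forall z, c z <= D.

Lemma bounded_section a : bounded_measurable (fun x => c (x, a)).
Proof.
split; first exact: measurable_section.
by exists D => x; rewrite ger0_norm.
Qed.

(** The two moments in the final estimate may have distinct optimal centers, [a]
    for the first and [b] for the second, while mass is routed through a single
    hub. If [b] is better than [a] for the second moment, it is close to [a]:
    integrating [(c a b - c x a) ^+ 2 <= c x b ^+ 2] and comparing the second
    moments gives [c a b ^+ 2 <= 2 * c a b * \int c x a]. *)
Lemma common_center (P : probability T R) (a b : T) :
  exists x0,
    \int[P]_x (c (x, x0) ^+ 2) <= \int[P]_x (c (x, b) ^+ 2) /\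
    c (a, x0) <= 2 * \int[P]_x c (x, a).
Proof.
have N0 : 0 <= \int[P]_x c (x, a) by apply: mean_ge0.
have bs := bounded_section.
have [ab|ba] := leP (\int[P]_x (c (x, a) ^+ 2)) (\int[P]_x (c (x, b) ^+ 2)).
  exists a; split => //.
  rewrite -(mean_cst P (c (a, a))) -meanZ//; apply: mean_le => [||x]; try by bounded.
  by rewrite (le_trans (c_triangle a x a))// c_sym mulr2n mulrDl mul1r.
exists b; split => //.
set t := c (a, b); set N := \int[P]_x c (x, a).
have t0 : 0 <= t by exact: c_ge0.
have key : t ^+ 2 - 2 * t * N + \int[P]_x (c (x, a) ^+ 2) <=
    \int[P]_x (c (x, b) ^+ 2).
  have -> : t ^+ 2 - 2 * t * N + \int[P]_x (c (x, a) ^+ 2) =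
      \int[P]_x ((t - c (x, a)) ^+ 2).
    rewrite (_ : (fun x => (t - c (x, a)) ^+ 2) = (fun x =>
      t ^+ 2 - 2 * t * c (x, a) + c (x, a) * c (x, a))); last first.
      by apply/funext => x; ring.
    by rewrite meanD ?meanB ?meanZ ?mean_cst; try bounded.
  apply: mean_le => [||x].
  - by apply: bounded_measurableM; bounded.
  - exact: bounded_measurableM.
  - rewrite -real_normK ?num_real// ler_sqr ?nnegrE// ler_norml.
    apply/andP; split.
      rewrite lerBrDl lerBlDr (le_trans (c_triangle x b a))//.
      by rewrite addrC lerD2r /t c_sym.
    by rewrite lerBlDl (le_trans (c_triangle a x b))// [c (a, x)]c_sym.
have tt : t ^+ 2 <= 2 * N * t by lra.
have [tz|tp] := eqVneq t 0; first by rewrite tz mulr_ge0.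
by rewrite -(ler_pM2r (_ : 0 < t)) ?lt0r ?tp// -expr2.
Qed.

(** Here [Phi - k * Psi] has mean 0. It is the sum of [k] times the centered
    [Phi - Psi], estimated by Cauchy-Schwarz, and of [1 - k] times the centered
    [Phi]. The absolute value of the latter is at most [D * L], which handles
    the moment at [a], and at most [1 / 2] on average, which pays for the
    distance from [a] to the hub: this is how [1 + D * L] appears. *)
Lemma likelihood_shift (P : probability T R) (Phi Psi : T -> R)
    (L k n m : R) (a x0 : T) :
  measurable_fun setT Phi -> (forall x, 0 <= Phi x <= 1) ->
  measurable_fun setT Psi -> (forall x, 0 <= Psi x <= 1) ->
  (forall x y, `|Phi x - Phi y| <= L * c (x, y)) ->
  0 <= L -> 0 <= k -> 0 <= n -> 0 <= m ->
  k * \int[P]_x Psi x = \int[P]_x Phi x ->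
  \int[P]_x ((Phi x - Psi x) ^+ 2) <= m ^+ 2 ->
  \int[P]_x (c (x, x0) ^+ 2) <= n ^+ 2 ->
  c (a, x0) <= 2 * \int[P]_x c (x, a) ->
  \int[P]_x (c (x, x0) * `|Phi x - k * Psi x|) <=
    k * (n * m) + `|1 - k| * ((1 + D * L) * \int[P]_x c (x, a)).
Proof.
move=> mPhi Phi01 mPsi Psi01 lip L0 k0 n0 m0 kE shift2 center2 center1.
have bs := bounded_section.
have bPhi : bounded_measurable Phi.
  by split => //; exists 1 => x; rewrite ger0_norm; case/andP: (Phi01 x).
have bPsi : bounded_measurable Psi.
  by split => //; exists 1 => x; rewrite ger0_norm; case/andP: (Psi01 x).
have bc j : bounded_measurable (fun _ : T => j) := bounded_measurable_cst T j.
set Q := \int[P]_x Phi x in kE *; set N := \int[P]_x c (x, a).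
have N0 : 0 <= N by apply: mean_ge0.
pose Delta x := Phi x - Psi x.
have bDelta : bounded_measurable Delta by exact: bounded_measurableB.
(* Both parts are centered: subtracting the mean does not increase the L2 norm
   of [Delta], and it makes [g] as small as the oscillation of [Phi]. *)
pose f x := Delta x - \int[P]_x Delta x.
have bf : bounded_measurable f by exact: bounded_measurableB.
pose g x := Phi x - Q.
have bg : bounded_measurable g by exact: bounded_measurableB.
have fgE x : Phi x - k * Psi x = k * f x + (1 - k) * g x.
  rewrite /f /g /Delta meanB// -/Q.
  rewrite (_ : k * (Phi x - Psi x - (Q - \int[P]_x Psi x)) =
    k * (Phi x - Psi x - Q) + k * \int[P]_x Psi x); last by ring.
  rewrite kE; ring.
have fpart : \int[P]_x (c (x, x0) * `|f x|) <= n * m.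
  apply: mean_mul_le => //; try exact: bounded_measurable_norm.
  rewrite (_ : (fun x => `|f x| ^+ 2) = fun x => f x ^+ 2); last first.
    by apply/funext => x; rewrite real_normK ?num_real.
  exact: le_trans (variance_le P bDelta) shift2.
have gDL x : `|g x| <= D * L.
  have -> : g x = \int[P]_y (Phi x - Phi y) by rewrite meanB// mean_cst.
  apply: le_trans (normr_mean_le _ _) _; first exact: bounded_measurableB.
  rewrite -[leRHS](mean_cst P); apply: mean_le => [||y] //.
    by apply: bounded_measurable_norm; exact: bounded_measurableB.
  by rewrite (le_trans (lip x y))// mulrC ler_wpM2r.
have gpart : \int[P]_x (c (x, x0) * `|g x|) <= (1 + D * L) * N.
  apply: (@le_trans _ _ (\int[P]_x (D * L * c (x, a) + c (a, x0) * `|g x|))).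
    apply: mean_le => [||x].
    - by bounded.
    - by bounded.
    - apply: (@le_trans _ _ ((c (x, a) + c (a, x0)) * `|g x|)).
        by rewrite ler_wpM2r.
      by rewrite mulrDl lerD2r mulrC ler_wpM2r.
  rewrite meanD ?meanZ//; try by bounded.
  have half := mean_deviation_le_half P mPhi Phi01.
  have : c (a, x0) * \int[P]_x `|g x| <= 2 * N * 2^-1.
    by apply: ler_pM => //; apply: mean_ge0.
  by rewrite -/N; nra.
apply: (@le_trans _ _ (\int[P]_x (k * (c (x, x0) * `|f x|) +
    `|1 - k| * (c (x, x0) * `|g x|)))).
  apply: mean_le => [||x].
  - by bounded.
  - by bounded.
  - rewrite fgE [X in _ <= X + _]mulrCA [X in _ <= _ + X]mulrCA -mulrDr.
    rewrite ler_wpM2l//.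
    by rewrite (le_trans (ler_normD _ _))// !normrM (ger0_norm k0).
rewrite meanD ?meanZ//; try by bounded.
by apply: lerD; rewrite ler_wpM2l.
Qed.

(** The first posterior is moved to an intermediate measure that has the same
    likelihood and the second prior, by reweighting a coupling of the priors;
    then the target is changed to the second posterior. Only the mean
    difference [Q - Qg] of the likelihoods under one prior enters the second
    step, and the scale [r] satisfies both [r <= 1 / Qr] and [r * Q <= 1]; this
    gives the three coefficients without any comparison of [Qr] with [Q]. *)
Lemma posterior_transport (Pr Pg mu nu : probability T R)
    (gamma : probability (T * T)%type R) (Phi Psi : T -> R)
    (L Qr Qg del1 del2 n K : R) (a b : T) :
  measurable_fun setT Phi -> (forall x, 0 <= Phi x <= 1) ->
  measurable_fun setT Psi -> (forall x, 0 <= Psi x <= 1) ->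
  0 <= L -> (forall x y, `|Phi x - Phi y| <= L * c (x, y)) ->
  0 <= del2 -> 0 <= n -> 0 < Qr -> 0 < Qg ->
  (\int[Pr]_x Phi x) = Qr -> (\int[Pg]_x Psi x) = Qg ->
  (forall A, measurable A -> mu A = \int[Pr]_(x in A) (Phi x / Qr)%:E)%E ->
  (forall A, measurable A -> nu A = \int[Pg]_(x in A) (Psi x / Qg)%:E)%E ->
  couples Pr Pg gamma -> (\int[gamma]_z (c z)%:E <= K%:E)%E ->
  \int[Pg]_x `|Phi x - Psi x| <= del1 ->
  \int[Pg]_x ((Phi x - Psi x) ^+ 2) <= del2 ^+ 2 ->
  \int[Pg]_x (c (x, b) ^+ 2) <= n ^+ 2 ->
  exists2 Gamma, couples mu nu Gamma &
   (\int[Gamma]_z (c z)%:E <=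
     ((1 + D * L) / Qr * K
      + (1 + D * L) / (Qr * Qg) * \int[Pg]_x c (x, a) * del1
      + Qg^-1 * n * del2)%:E)%E.
Proof.
move=> mPhi Phi01 mPsi Psi01 L0 lip del20 n0 Qr0 Qg0 QrE QgE muE nuE.
move=> g gK shift1 shift2 bn.
have Phi0 x : 0 <= Phi x by case/andP: (Phi01 x).
have Psi0 x : 0 <= Psi x by case/andP: (Psi01 x).
have D0 : 0 <= D := le_trans (c_ge0 point) (cD point).
have bPhi : bounded_measurable Phi.
  by split => //; exists 1 => x; rewrite ger0_norm; case/andP: (Phi01 x).
have bPsi : bounded_measurable Psi.
  by split => //; exists 1 => x; rewrite ger0_norm; case/andP: (Psi01 x).
have bc j : bounded_measurable (fun _ : T => j) := bounded_measurable_cst T j.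
(* [Q] is the evidence of the likelihood of the first posterior under the prior
   of the second one. The scale [r] is the largest for which the reweighted
   priors have mass at most 1. *)
pose Q := \int[Pg]_x Phi x.
have Q0 : 0 <= Q by apply: mean_ge0.
pose r := (Num.max Qr Q)^-1.
have mx0 : 0 < Num.max Qr Q by rewrite lt_max Qr0.
have r0 : 0 < r by rewrite invr_gt0.
have rQr : r <= Qr^-1 by rewrite lef_pV2 ?posrE// le_max lexx.
have rQ : r * Q <= 1 by rewrite mulrC ler_pdivrMr// mul1r le_max lexx orbT.
pose k := Q / Qg.
have k0 : 0 <= k by rewrite divr_ge0// ltW.
pose v x := Psi x / Qg.
have v0 x : 0 <= v x by rewrite divr_ge0// ltW.
have bv : bounded_measurable v by exact: bounded_measurableM.
(* The intermediate measure: the mass that [r * Phi] lacks is taken from the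
   target, so that its difference with the target is [r * (Phi - k * Psi)]. *)
pose u x := r * Phi x + (1 - r * Q) * v x.
have bu : bounded_measurable u by bounded.
have u0 x : 0 <= u x.
  by rewrite addr_ge0// mulr_ge0// ?subr_ge0// ltW.
have v1 : \int[Pg]_x v x = 1.
  rewrite /v (_ : (fun x => Psi x / Qg) = fun x => Qg^-1 * Psi x); last first.
    by apply/funext => x; rewrite mulrC.
  by rewrite meanZ// QgE mulVf// gt_eqF.
have u1 : (\int[Pg]_x (u x)%:E = 1)%E.
  rewrite bounded_measurable_EFin// meanD ?meanZ//; try exact: bounded_measurableM.
  by rewrite v1 mulr1 -/Q addrC subrK.
have ufin : (\int[Pg]_x (u x)%:E < +oo)%E by rewrite u1 ltry.
have [tau' tauE'] := exists_pushed_density (@measurable_id _ _ setT) u0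
  bu.1 ufin.
have tauT : tau' setT = 1%E by rewrite tauE'// preimage_id.
have [tau tau'E] := exists_probability tauT.
have tauE A : measurable A -> (tau A = \int[Pg]_(x in A) (u x)%:E)%E.
  by move=> mA; rewrite tau'E -[RHS]tauE'.
have r0s : 0 <= r <= Qr^-1 by rewrite ltW.
have uPhi x : r * Phi x <= u x by rewrite lerDl mulr_ge0// subr_ge0.
have muE' A : measurable A -> (mu A = \int[Pr]_(x in A) (Qr^-1 * Phi x)%:E)%E.
  by move=> mA; rewrite muE//; under eq_integral do rewrite mulrC.
have mass : (\int[Pr]_x (r * Phi x)%:E = 1 \/ \int[Pg]_x (r * Phi x)%:E = 1)%E.
  rewrite !bounded_measurable_EFin; try by apply: bounded_measurableM => //; bounded.
  rewrite !meanZ// QrE -/Q /r.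
  by case: (leP Qr Q) => h; [right|left]; rewrite mulVf ?gt_eqF// (lt_le_trans Qr0).
have [G1 G1c G1cost] := reweight_coupling c_ge0 mc g mPhi Phi01 L0 lip cD r0s
  bu.1 uPhi muE' tauE mass.
have [x0 [ctr2 ctr1]] := common_center Pg a b.
have [G Gc Gcost] := change_target c_ge0 mc c_sym c_triangle x0 G1c u0 bu.1 v0
  bv.1 tauE nuE.
exists G => //; apply: (le_trans Gcost).
have kQ : k * \int[Pg]_x Psi x = \int[Pg]_x Phi x.
  by rewrite QgE divfK// gt_eqF.
have shift := likelihood_shift mPhi Phi01 mPsi Psi01 lip L0 k0 n0 del20 kQ shift2
  (le_trans ctr2 bn) ctr1.
have bs := bounded_section.
rewrite (bounded_measurable_EFin Pg); last by bounded.
set N := \int[Pg]_x c (x, a) in shift *.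
have N0 : 0 <= N by apply: mean_ge0.
have -> : \int[Pg]_x (c (x, x0) * `|u x - v x|) =
    r * \int[Pg]_x (c (x, x0) * `|Phi x - k * Psi x|).
  rewrite -meanZ; last by bounded.
  apply: eq_Rintegral => x _; rewrite mulrCA; congr (_ * _).
  rewrite -[X in X * _](gtr0_norm r0) -normrM; congr `|_|.
  by rewrite /u /v /k; ring.
have K0 : 0 <= K.
  by rewrite -lee_fin (le_trans _ gK)// integral_ge0// => z _; rewrite lee_fin.
have DL0 : 0 <= 1 + D * L by rewrite addr_ge0// mulr_ge0.
apply: (@le_trans _ _ (r * (1 + D * L) * K + r * (k * (n * del2) +
    `|1 - k| * ((1 + D * L) * N)))%:E).
  rewrite [X in (_ <= X)%E]EFinD leeD//.
    apply: (le_trans G1cost); rewrite [X in (_ <= X)%E]EFinM.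
    by rewrite lee_wpmul2l// lee_fin mulr_ge0// ltW.
  by rewrite lee_fin ler_wpM2l// ltW.
rewrite lee_fin [r * (_ + _ * (_ * _))]mulrDr addrA [leRHS]addrAC.
have Qg1 : 0 <= Qg^-1 by rewrite invr_ge0 ltW.
have Qr1 : 0 <= Qr^-1 by rewrite invr_ge0 ltW.
apply: lerD; first apply: lerD.
- by rewrite mulrC [leRHS]mulrC ler_wpM2l// mulrC ler_wpM2l.
- rewrite (_ : r * (k * (n * del2)) = (r * Q) * (Qg^-1 * n * del2)).
    by rewrite ler_piMl// !mulr_ge0.
  by rewrite /k; ring.
have kQg : `|1 - k| <= Qg^-1 * del1.
  have -> : 1 - k = Qg^-1 * (Qg - Q) by rewrite /k; field; rewrite gt_eqF.
  rewrite normrM ger0_norm// ler_wpM2l//.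
  rewrite distrC -QgE -meanB//; apply: le_trans shift1.
  by apply: normr_mean_le; bounded.
have del10 : 0 <= del1 by apply: le_trans shift1; apply: mean_ge0.
apply: (@le_trans _ _ (Qr^-1 * ((Qg^-1 * del1) * ((1 + D * L) * N)))).
  apply: ler_pM => //; first exact: ltW.
    by rewrite !mulr_ge0.
  by rewrite ler_wpM2r// mulr_ge0.
by rewrite invfM le_eqVlt; apply/orP; left; apply/eqP; ring.
Qed.

End posterior_stability.

(** * Metrics on a subset of the space *)

Lemma measurable_fun_sublevel (R : realType) d (X : measurableType d) (f : X -> R) :
  (forall r, measurable [set x | f x < r]) -> measurable_fun setT f.
Proof.
move=> fr _; apply: (measurability _ (RGenInftyO.measurableE R)) => //.
move=> /= _ [_ [a ->] <-]; rewrite setTI.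
by rewrite (_ : _ @^-1` _ = [set x | f x < a])//; apply/seteqP; split => x /=;
  rewrite in_itv.
Qed.

Section retraction.
Context (R : realType) (d : nat).
Variables (E : set (d.-tuple R)) (dE : d.-tuple R -> d.-tuple R -> R).
Hypothesis dE_metric : metric_on E dE.
Hypothesis dE_borel : borel_compatible E dE.
Variable e0 : d.-tuple R.
Hypothesis Ee0 : E e0.

Lemma measurable_carrier : measurable E.
Proof.
apply: dE_borel.1; split => // x Ex; exists 1 => //.
Qed.

(** Retracting onto [E] turns [dE] and the functions on [E] into total measurable
    ones, in particular [dE] into a pseudometric on the whole space. Nothing
    changes for measures that are carried by [E]. *)
Definition retract (x : d.-tuple R) : d.-tuple R := if x \in E then x else e0.

Lemma retract_in x : E (retract x).
Proof. by rewrite /retract; case: ifPn => // /set_mem. Qed.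

Lemma retract_id x : E x -> retract x = x.
Proof. by move=> Ex; rewrite /retract mem_set. Qed.

Lemma measurable_retract : measurable_fun setT retract.
Proof.
apply: measurable_fun_ifT => //.
apply: (measurable_fun_bool true).
rewrite setTI (_ : _ @^-1` _ = E); first exact: measurable_carrier.
by apply/seteqP; split => x /=; [exact: set_mem|exact: mem_set].
Qed.

Lemma measurable_lipschitz (f : d.-tuple R -> R) L :
  lipschitz_with E dE f L -> measurable_fun setT (f \o retract).
Proof.
move=> [L0 lip]; apply: measurable_fun_sublevel => r.
rewrite (_ : [set x | _] = retract @^-1` (E `&` [set x | f x < r])).
  rewrite -[X in measurable X]setTI; apply: measurable_retract => //.
  apply: dE_borel.1; split => [x [] //|x [Ex /= fxr]].
  have L1 : 0 < L + 1 by rewrite ltr_wpDl.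
  exists ((r - f x) / (L + 1)); first by rewrite divr_gt0// subr_gt0.
  move=> y Ey; rewrite ltr_pdivlMr// => dxy; split => //=.
  have dxy0 : 0 <= dE x y by have [+ _ _ _] := dE_metric; exact.
  have := lip _ _ Ex Ey; rewrite ler_norml => /andP[+ _]; nra.
by apply/seteqP; split => x /= => [fr|[]//]; split => //; exact: retract_in.
Qed.

Definition retract_dist (z : d.-tuple R * d.-tuple R) : R :=
  dE (retract z.1) (retract z.2).

Lemma retract_dist_ge0 z : 0 <= retract_dist z.
Proof. by have [+ _ _ _] := dE_metric; apply; exact: retract_in. Qed.

Lemma retract_dist_sym x y : retract_dist (x, y) = retract_dist (y, x).
Proof. by have [_ _ + _] := dE_metric; apply; exact: retract_in. Qed.

Lemma retract_dist_triangle x y z :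
  retract_dist (x, z) <= retract_dist (x, y) + retract_dist (y, z).
Proof. by have [_ _ _] := dE_metric; apply; exact: retract_in. Qed.

(** The distance is the infimum of [dE x s + dE y s] over a countable dense set of
    points [s], and each of these functions is measurable as a sum of Lipschitz
    functions of one variable. *)
Lemma measurable_retract_dist : measurable_fun setT retract_dist.
Proof.
have [d0 dz dsym dtri] := dE_metric.
have mdist s : E s -> measurable_fun setT (fun x => dE (retract x) s).
  move=> Es; apply: (@measurable_lipschitz (dE^~ s) 1); split => // x y Ex Ey.
  rewrite mul1r ler_norml; apply/andP; split.
    by rewrite lerNl opprB lerBlDr [dE x y]dsym// dtri.
  by rewrite lerBlDr dtri.
apply: measurable_fun_sublevel => r.
have [S [cS SE Sdense]] := dE_borel.2.
have /countable_injP[f injf] := cS.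
pose s k := 'pinv_(cst e0) S f k.
have sS k : (f @` S) k -> S (s k).
  by case=> t St <-; rewrite /s pinvKV// inE.
have -> : [set z | retract_dist z < r] = \bigcup_(k in f @` S)
    [set z | dE (retract z.1) (s k) + dE (retract z.2) (s k) < r].
  apply/seteqP; split => [z /= zr|z [k Sk] /=]; last first.
    apply: le_lt_trans; rewrite [X in _ + X]dsym; [|exact: retract_in|exact/SE/sS].
    by apply: dtri; [exact: retract_in|exact/SE/sS|exact: retract_in].
  have [||t St td] := Sdense (retract z.1) ((r - retract_dist z) / 2).
  - exact: retract_in.
  - by rewrite divr_gt0// subr_gt0.
  exists (f t); first by exists t.
  rewrite /= /s pinvKV ?inE//.
  have := dtri _ _ _ (retract_in z.2) (retract_in z.1) (SE _ St).
  by rewrite -/(retract_dist (z.2, z.1)) retract_dist_sym -surjective_pairing; lra.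
apply: bigcup_measurable => k /sS/SE Esk.
have m1 : measurable_fun setT (fun z : d.-tuple R * d.-tuple R =>
    dE (retract z.1) (s k) + dE (retract z.2) (s k)).
  apply: measurable_funD.
    exact: (measurableT_comp (mdist _ Esk) measurable_fst).
  exact: (measurableT_comp (mdist _ Esk) measurable_snd).
rewrite (_ : [set z | _] = (fun z : d.-tuple R * d.-tuple R =>
    dE (retract z.1) (s k) + dE (retract z.2) (s k)) @^-1` `]-oo, r[%classic).
  by rewrite -[X in measurable X]setTI; exact: m1.
by apply/seteqP; split => z /=; rewrite in_itv.
Qed.

(** The Lipschitz constants form a closed set, which contains its infimum. *)
Lemma lipschitz_with_Lip (f : d.-tuple R -> R) :
  lipschitz_on_set E dE f -> lipschitz_with E dE f (Lip E dE f).
Proof.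
move=> [L0 lipL0]; have ne : [set L | lipschitz_with E dE f L] !=set0 by exists L0.
split; first by apply: lb_le_inf => // L [].
move=> x y Ex Ey; have [d0 _ _ _] := dE_metric.
have [dxy|dxy] := eqVneq (dE x y) 0.
  by rewrite dxy mulr0; have := lipL0.2 _ _ Ex Ey; rewrite dxy mulr0.
have dp : 0 < dE x y by rewrite lt0r dxy d0.
rewrite -ler_pdivrMr//; apply: lb_le_inf => // L [_ /(_ _ _ Ex Ey)].
by rewrite ler_pdivrMr.
Qed.

End retraction.

(** * Distributions given by a density on a subset *)

Section distributions_on_subset.
Context (R : realType) (d : nat).
Variables (E : set (d.-tuple R)) (dE : d.-tuple R -> d.-tuple R -> R).
Hypothesis mE : measurable E.

Lemma pdf_carrier (P : probability (d.-tuple R) R) rho :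
  has_pdf E P rho -> P E = 1%E.
Proof.
by move=> [_ _ PE]; rewrite PE// setIid -[in LHS](setIT E) -PE// probability_setT.
Qed.

Lemma pdf_integral (P : probability (d.-tuple R) R) (rho f g : d.-tuple R -> R) :
  has_pdf E P rho -> (forall x, 0 <= f x) -> measurable_fun setT f ->
  (forall x, E x -> g x = f x) ->
  (\int[leb d]_(x in E) (g x * rho x)%:E = \int[P]_x (f x)%:E)%E.
Proof.
move=> [mrho rho0 PE] f0 mf gf.
have mr : measurable_fun setT (rho \_ E) by apply/(measurable_restrictT _ mE).
have r0 x : 0 <= (rho \_ E) x.
  by rewrite patchE; case: ifPn => // /set_mem; exact: rho0.
rewrite (integral_density (m := leb d) r0 mr)//.
  rewrite [LHS]integral_mkcond; apply: eq_integral => x _; rewrite !patchE.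
  by case: ifPn => [/set_mem/gf->//|_]; rewrite mulr0.
move=> A mA; transitivity (\int[leb d]_(x in E `&` A) (rho x)%:E)%E.
  exact: PE.
rewrite integral_mkcondl; apply: eq_integral => x _.
by rewrite !patchE; case: ifPn.
Qed.

Lemma evidence_expectation (P : probability (d.-tuple R) R)
    (rho Phi Phi' : d.-tuple R -> R) :
  has_pdf E P rho ->
  (forall x, 0 <= Phi' x) -> measurable_fun setT Phi' ->
  (forall x, E x -> Phi x = Phi' x) ->
  evidence E Phi rho = \int[P]_x Phi' x.
Proof.
move=> Prho Phi'0 mPhi' PhiE.
by rewrite /evidence /Rintegral (pdf_integral Prho (f := Phi')).
Qed.

Lemma posterior_density (P Ppost : probability (d.-tuple R) R)
    (rho Phi Phi' : d.-tuple R -> R) :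
  has_pdf E P rho -> has_pdf E Ppost (posterior_pdf E Phi rho) ->
  (forall x, 0 <= Phi' x) -> measurable_fun setT Phi' ->
  (forall x, E x -> Phi x = Phi' x) -> 0 < evidence E Phi rho ->
  forall A, measurable A ->
    Ppost A = (\int[P]_(x in A) (Phi' x / evidence E Phi rho)%:E)%E.
Proof.
move=> Prho Ppostrho Phi'0 mPhi' PhiE Q0 A mA.
set Q := evidence E Phi rho in Q0 *.
have [_ _ ->] := Ppostrho => //; rewrite [RHS]integral_setE.
rewrite -(pdf_integral (g := fun x => Phi x / Q * \1_A x) Prho).
- rewrite integral_mkcondr; apply: eq_integral => x _.
  rewrite patchE indicE /posterior_pdf -/Q.
  by case: ifPn => _; rewrite ?mulr1 ?mulr0 ?mul0r// mulrAC.
- by move=> x; rewrite mulr_ge0// divr_ge0// ltW.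
- by apply: measurable_funM; [exact: measurable_funM|exact: measurable_indic].
- by move=> x Ex; rewrite PhiE.
Qed.

(** A coupling of distributions that are carried by [E] is carried by the square
    of [E]. *)
Lemma coupling_cost (e0 : d.-tuple R) (P1 P2 : probability (d.-tuple R) R)
    (gamma : probability (d.-tuple R * d.-tuple R)%type R) :
  E e0 -> metric_on E dE -> borel_compatible E dE ->
  coupling P1 P2 gamma -> P1 E = 1%E -> P2 E = 1%E ->
  (\int[gamma]_(z in E `*` E) (dE z.1 z.2)%:E =
   \int[gamma]_z (retract_dist E dE e0 z)%:E)%E.
Proof.
move=> Ee0 dE_metric dE_borel g P1E P2E.
have mEC : measurable (~` E) by exact: measurableC.
have mEE : measurable (E `*` E) by exact: measurableX.
have null (P : probability (d.-tuple R) R) : P E = 1%E -> P (~` E) = 0%E.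
  by move=> PE; rewrite probability_setC// PE subee.
have gE : gamma (~` (E `*` E)) = 0%E.
  apply/eqP; rewrite eq_le measure_ge0 andbT.
  apply: (@le_trans _ _ (gamma ((~` E `*` setT) `|` (setT `*` ~` E)))).
    apply: le_measure; rewrite ?inE.
    - exact: measurableC.
    - by apply: measurableU; exact: measurableX.
    - move=> [x y] /= /not_andP[nE|nE]; [left|right] => //.
  apply: le_trans; first by apply: measureU2; exact: measurableX.
  have gr : gamma (~` E `*` setT) = 0%E by rewrite (g _ mEC).1 null.
  have gg : gamma (setT `*` ~` E) = 0%E by rewrite (g _ mEC).2 null.
  rewrite -[leRHS]adde0; apply: leeD; rewrite le_eqVlt; apply/orP; left; apply/eqP.
    exact: gr.
  exact: gg.
have mc : measurable_fun setT (fun z => (retract_dist E dE e0 z)%:E).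
  by apply/measurable_EFinP; exact: measurable_retract_dist.
rewrite [RHS](ge0_negligible_integral _ _ mc _ gE)//; last 2 first.
- exact: measurableC.
- by move=> z _; rewrite lee_fin retract_dist_ge0.
rewrite setTD setCK; apply: eq_integral => -[x y] /set_mem[/= Ex Ey].
by rewrite /retract_dist /= !retract_id.
Qed.

End distributions_on_subset.

(** * Stability of the posterior *)

(** Factor out the larger exponential and use [1 - expR (- t) <= t]. *)
Lemma expRN_lipschitz (R : realType) (M a b : R) :
  expR (- a) <= M -> expR (- b) <= M ->
  `|expR (- a) - expR (- b)| <= M * `|a - b|.
Proof.
wlog ab : a b / a <= b => [hw aM bM|aM _].
  have [/hw|/ltW/hw] := leP a b; first exact.
  by rewrite distrC [`|a - b|]distrC; exact.
rewrite [`|a - b|]distrC !ger0_norm ?subr_ge0//; last by rewrite ler_expR lerN2.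
have -> : expR (- b) = expR (- a) * expR (- (b - a)).
  by rewrite -expRD; congr expR; ring.
have h := expR_ge1Dx (- (b - a)).
have p := expR_ge0 (- a).
apply: (@le_trans _ _ (expR (- a) * (b - a))); last by rewrite ler_wpM2r// subr_ge0.
by rewrite -[X in X - _]mulr1 -mulrBr ler_wpM2l//; lra.
Qed.

Lemma ereal_inf_real_adherent (R : realType) (I : Type) (A : set I) (N : I -> R) :
  A !=set0 -> (forall i, A i -> 0 <= N i) ->
  exists2 w : R, ereal_inf [set (N i)%:E | i in A] = w%:E &
    forall e, 0 < e -> exists2 i, A i & N i < w + e.
Proof.
move=> [i0 Ai0] N0; set S := [set _ | _ in _].
have inf0 : (0 <= ereal_inf S)%E.
  by apply: le_ereal_inf_tmp => _ [i Ai <-]; rewrite lee_fin N0.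
have inffin : ereal_inf S \is a fin_num.
  rewrite ge0_fin_numE//; apply: (@le_lt_trans _ _ (N i0)%:E); last exact: ltry.
  by apply: ereal_inf_lbound; exists i0.
exists (fine (ereal_inf S)); first by rewrite fineK.
move=> e eps0; have [_ [i Ai <-]] := lb_ereal_inf_adherent eps0 inffin.
by rewrite -(fineK inffin) -EFinD lte_fin => lt; exists i.
Qed.

Theorem theorem2 (R : realType) (d : nat)
  (E : set (d.-tuple R)) (dE : d.-tuple R -> d.-tuple R -> R) (D : R)
  (dE_metric : metric_on E dE)
  (dE_complete : complete_on E dE)
  (dE_borel : borel_compatible E dE)
  (dE_bounded : forall x1 x2, E x1 -> E x2 -> dE x1 x2 <= D)
  (P0r P0g : probability (d.-tuple R) R) (rho0r rho0g : d.-tuple R -> R)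
  (P0r_pdf : has_pdf E P0r rho0r)
  (P0g_pdf : has_pdf E P0g rho0g)
  (P0r_W2 : (Wnorm E dE 2 rho0r < +oo)%E)
  (P0g_W2 : (Wnorm E dE 2 rho0g < +oo)%E)
  (* u |-> rho_(y|u)(y|u), at the fixed data y *)
  (likr likg : d.-tuple R -> R)
  (lr lg Phir Phig : d.-tuple R -> R)
  (likr_Phir : proportional_on E likr Phir)
  (likg_Phig : proportional_on E likg Phig)
  (lr_ge0 : forall u, E u -> 0 <= lr u)
  (lg_ge0 : forall u, E u -> 0 <= lg u)
  (PhirE : forall u, E u -> Phir u = expR (- lr u))
  (PhigE : forall u, E u -> Phig u = expR (- lg u))
  (Phir_lip : lipschitz_on_set E dE Phir)
  (Phig_lip : lipschitz_on_set E dE Phig)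
  (Phir_L2 : (L2_norm E rho0g Phir < +oo)%E)
  (Phig_L2 : (L2_norm E rho0g Phig < +oo)%E)
  (Qr_gt0 : 0 < evidence E Phir rho0r)
  (Qg_gt0 : 0 < evidence E Phig rho0g)
  (Ppostr Ppostg : probability (d.-tuple R) R)
  (Ppostr_pdf : has_pdf E Ppostr (posterior_pdf E Phir rho0r))
  (Ppostg_pdf : has_pdf E Ppostg (posterior_pdf E Phig rho0g))
  (eps1 eps2 eps3 : R)
  (W1_prior : (W1 E dE P0r P0g <= eps1%:E)%E)
  (l_L1 : (L1_norm E rho0g (fun u => lr u - lg u)%R <= eps2%:E)%E)
  (l_L2 : (L2_norm E rho0g (fun u => lr u - lg u)%R <= eps3%:E)%E) :
  let Qr := evidence E Phir rho0r in
  let Qg := evidence E Phig rho0g in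
  let maxPhi := sup (Phir @` E `|` Phig @` E) in
  let C1 := ((1 + D * Lip E dE Phir) / Qr)%:E in
  let C2 := ((maxPhi / (Qr * Qg) * (1 + D * Lip E dE Phir))%:E
             * Wnorm E dE 1 rho0g)%E in
  let C3 := ((maxPhi / Qg)%:E * Wnorm E dE 2 rho0g)%E in
  (W1 E dE Ppostr Ppostg <= C1 * eps1%:E + C2 * eps2%:E + C3 * eps3%:E)%E.
Proof.
pose Qr := evidence E Phir rho0r; pose Qg := evidence E Phig rho0g.
pose M := sup (Phir @` E `|` Phig @` E).
pose C1 := ((1 + D * Lip E dE Phir) / Qr)%:E.
pose C2 := ((M / (Qr * Qg) * (1 + D * Lip E dE Phir))%:E
  * Wnorm E dE 1 rho0g)%E.
pose C3 := ((M / Qg)%:E * Wnorm E dE 2 rho0g)%E.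
rewrite -[X in is_true X]/(W1 E dE Ppostr Ppostg <=
  C1 * eps1%:E + C2 * eps2%:E + C3 * eps3%:E)%E.
have [d0 _ _ _] := dE_metric.
(* On an empty [E] every evidence vanishes. *)
have [e0 Ee0] : E !=set0.
  apply/set0P/eqP => E0; move: Qr_gt0.
  by rewrite /evidence E0 Rintegral_set0 ltxx.
have mE := measurable_carrier dE_borel.
pose pi := retract E e0; pose c := retract_dist E dE e0.
have piE x : E (pi x) by exact: retract_in.
have pi_id x : E x -> pi x = x by exact: retract_id.
pose L := Lip E dE Phir.
have lipr : lipschitz_with E dE Phir L by exact: lipschitz_with_Lip.
have [Lg lipg] := Phig_lip.
pose Phi x := Phir (pi x); pose Psi x := Phig (pi x).
have mPhi : measurable_fun setT Phi.
  exact: (measurable_lipschitz dE_metric dE_borel Ee0 lipr).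
have mPsi : measurable_fun setT Psi.
  exact: (measurable_lipschitz dE_metric dE_borel Ee0 lipg).
have Phi01 x : 0 <= Phi x <= 1.
  by rewrite /Phi PhirE// expR_ge0 -[leRHS]expR0 ler_expR oppr_le0 lr_ge0.
have Psi01 x : 0 <= Psi x <= 1.
  by rewrite /Psi PhigE// expR_ge0 -[leRHS]expR0 ler_expR oppr_le0 lg_ge0.
have Phi0 x : 0 <= Phi x by case/andP: (Phi01 x).
have Psi0 x : 0 <= Psi x by case/andP: (Psi01 x).
have PhirPhi x : E x -> Phir x = Phi x by move=> Ex; rewrite /Phi pi_id.
have PhigPsi x : E x -> Phig x = Psi x by move=> Ex; rewrite /Psi pi_id.
have ubM : has_ubound (Phir @` E `|` Phig @` E).
  exists 1 => _ [[x Ex <-]|[x Ex <-]].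
    by rewrite PhirPhi//; case/andP: (Phi01 x).
  by rewrite PhigPsi//; case/andP: (Psi01 x).
have PhiM x : Phi x <= M by apply: ub_le_sup => //; left; exists (pi x).
have PsiM x : Psi x <= M by apply: ub_le_sup => //; right; exists (pi x).
have M0 : 0 <= M := le_trans (Phi0 e0) (PhiM e0).
have c0 := retract_dist_ge0 dE_metric Ee0.
have csym := retract_dist_sym dE_metric Ee0.
have ctri := retract_dist_triangle dE_metric Ee0.
have mc := measurable_retract_dist dE_metric dE_borel Ee0.
have cD z : c z <= D by apply: dE_bounded; exact: retract_in.
have D0 : 0 <= D := le_trans (c0 point) (cD point).
have cE x y : E x -> E y -> c (x, y) = dE x y.
  by move=> Ex Ey; rewrite /c /retract_dist/= !retract_id.
have QrE : \int[P0r]_x Phi x = Qr.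
  by rewrite /Qr (evidence_expectation mE P0r_pdf Phi0 mPhi PhirPhi).
have QgE : \int[P0g]_x Psi x = Qg.
  by rewrite /Qg (evidence_expectation mE P0g_pdf Psi0 mPsi PhigPsi).
have muE := posterior_density mE P0r_pdf Ppostr_pdf Phi0 mPhi PhirPhi Qr_gt0.
have nuE := posterior_density mE P0g_pdf Ppostg_pdf Psi0 mPsi PhigPsi Qg_gt0.
have lip x y : `|Phi x - Phi y| <= L * c (x, y) by apply: lipr.2.
have bPhi : bounded_measurable Phi.
  by split => //; exists 1 => x; rewrite ger0_norm; case/andP: (Phi01 x).
have bPsi : bounded_measurable Psi.
  by split => //; exists 1 => x; rewrite ger0_norm; case/andP: (Psi01 x).
have bdiff := bounded_measurableB bPhi bPsi.
pose l x := `|lr (pi x) - lg (pi x)|.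
have l0 x : 0 <= l x by exact: normr_ge0.
have ml : measurable_fun setT l.
  rewrite (_ : l = (fun x => `|ln (Psi x) - ln (Phi x)|)); last first.
    by apply/funext => x; rewrite /Psi /Phi PhirE// PhigE// !expRK opprK addrC.
  apply: measurableT_comp => //; apply: measurable_funB.
    exact: (measurableT_comp (@measurable_ln R) mPsi).
  exact: (measurableT_comp (@measurable_ln R) mPhi).
have diffl x : `|Phi x - Psi x| <= M * l x.
  have := PhiM x; have := PsiM x; rewrite /Phi /Psi PhirE// PhigE// => h1 h2.
  exact: expRN_lipschitz.
have shift1 : \int[P0g]_x `|Phi x - Psi x| <= M * eps2.
  rewrite -lee_fin -bounded_measurable_EFin; last exact: bounded_measurable_norm.
  apply: (@le_trans _ _ (\int[P0g]_x (M * l x)%:E)%E).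
    apply: ge0_le_integral_EFin => //; first exact: (bounded_measurable_norm bdiff).1.
    exact: measurable_funM.
  under eq_integral do rewrite EFinM.
  rewrite ge0_integralZl//; last 2 first.
  - exact/measurable_EFinP.
  - by move=> x _; rewrite lee_fin.
  rewrite EFinM lee_wpmul2l ?lee_fin//; apply: le_trans l_L1.
  rewrite /L1_norm (pdf_integral mE P0g_pdf (f := l))// => x Ex.
  by rewrite /l pi_id.
have eps20 : 0 <= eps2.
  rewrite -lee_fin; apply: le_trans l_L1; apply: integral_ge0 => x Ex.
  by rewrite lee_fin mulr_ge0//; have [_ + _] := P0g_pdf; exact.
have eps30 : 0 <= eps3 by rewrite -lee_fin; apply: le_trans l_L2; exact: poweR_ge0.
have shift2 : \int[P0g]_x ((Phi x - Psi x) ^+ 2) <= (M * eps3) ^+ 2.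
  have ml2 : measurable_fun setT (fun x => l x ^+ 2) by exact: measurable_funX.
  have L2E : (\int[leb d]_(x in E) (`|lr x - lg x| ^+ 2 * rho0g x)%:E =
      \int[P0g]_x (l x ^+ 2)%:E)%E.
    apply: (pdf_integral mE P0g_pdf (f := fun x => l x ^+ 2)) => // [x|x Ex].
      exact: sqr_ge0.
    by rewrite /l pi_id.
  have l2le : (\int[P0g]_x (l x ^+ 2)%:E <= (eps3 ^+ 2)%:E)%E.
    move: l_L2; rewrite /L2_norm L2E => l_L2.
    have l2ge0 : (0 <= \int[P0g]_x (l x ^+ 2)%:E)%E.
      by apply: integral_ge0 => x _; rewrite lee_fin sqr_ge0.
    have l2fin : (\int[P0g]_x (l x ^+ 2)%:E)%E \is a fin_num.
      rewrite ge0_fin_numE//; apply: (@lty_poweRy _ _ 2^-1); first by rewrite invr_eq0.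
      exact: le_lt_trans l_L2 (ltry _).
    have f0 := fine_ge0 l2ge0.
    move: l_L2; rewrite -(fineK l2fin) poweR_EFin !lee_fin powR12_sqrt// => h.
    by rewrite -(sqr_sqrtr f0) ler_sqr ?nnegrE ?sqrtr_ge0.
  rewrite -lee_fin -(bounded_measurable_EFin P0g (f := fun x => (Phi x - Psi x) ^+ 2));
    last exact: bounded_measurableM.
  apply: (@le_trans _ _ (\int[P0g]_x ((M ^+ 2) * (l x ^+ 2))%:E)%E).
    apply: ge0_le_integral_EFin => [x|||x].
    - exact: sqr_ge0.
    - exact: (bounded_measurableM bdiff bdiff).1.
    - exact: measurable_funM.
    - by rewrite -exprMn -real_normK ?num_real// ler_sqr ?nnegrE// mulr_ge0.
  under eq_integral do rewrite EFinM.
  rewrite ge0_integralZl ?lee_fin ?sqr_ge0//; last 2 first.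
  - exact/measurable_EFinP.
  - by move=> x _; rewrite lee_fin sqr_ge0.
  by rewrite exprMn [leRHS]EFinM lee_wpmul2l ?lee_fin ?sqr_ge0.
have bs a := bounded_section c0 mc cD a.
pose N1 a := \int[P0g]_x c (x, a).
pose N2 a := Num.sqrt (\int[P0g]_x (c (x, a) ^+ 2)).
have W1E : Wnorm E dE 1 rho0g = ereal_inf [set (N1 a)%:E | a in E].
  congr ereal_inf; apply: eq_imagel => a Ea.
  rewrite invr1 poweRe1; last first.
    apply: integral_ge0 => x Ex; rewrite lee_fin mulr_ge0 ?powR_ge0//.
    by have [_ + _] := P0g_pdf; exact.
  rewrite -bounded_measurable_EFin//.
  apply: (pdf_integral mE P0g_pdf (f := fun x => c (x, a))) => // [|x Ex].
    exact: (bs a).1.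
  by rewrite powRr1 ?d0// cE.
have W2E : Wnorm E dE 2 rho0g = ereal_inf [set (N2 a)%:E | a in E].
  congr ereal_inf; apply: eq_imagel => a Ea.
  rewrite (pdf_integral mE P0g_pdf (f := fun x => c (x, a) ^+ 2)); last 3 first.
  - by move=> x; exact: sqr_ge0.
  - by apply: measurable_funX; exact: (bs a).1.
  - by move=> x Ex; rewrite powR_mulrn ?d0// cE.
  rewrite (bounded_measurable_EFin P0g (f := fun x => c (x, a) ^+ 2)); last first.
    exact: bounded_measurableM.
  rewrite poweR_EFin powR12_sqrt//.
  by apply: mean_ge0 => x; exact: sqr_ge0.
have neE : E !=set0 by exists e0.
have [w1 W1w1 near1] := ereal_inf_real_adherent neE (N := N1)
  (fun a _ => mean_ge0 P0g (fun x => c0 (x, a))).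
have [w2 W2w2 near2] := ereal_inf_real_adherent neE (N := N2)
  (fun a _ => sqrtr_ge0 _).
have P0rE := pdf_carrier mE P0r_pdf; have P0gE := pdf_carrier mE P0g_pdf.
have PrE := pdf_carrier mE Ppostr_pdf; have PgE := pdf_carrier mE Ppostg_pdf.
have costE := coupling_cost mE Ee0 dE_metric dE_borel.
have DL0 : 0 <= 1 + D * L by rewrite addr_ge0// mulr_ge0// lipr.1.
pose k1 := (1 + D * L) / Qr; pose k2 := M / (Qr * Qg) * (1 + D * L).
pose k3 := M / Qg.
have k10 : 0 <= k1 by rewrite divr_ge0// ltW.
have k20 : 0 <= k2 by rewrite mulr_ge0// divr_ge0// mulr_ge0// ltW.
have k30 : 0 <= k3 by rewrite divr_ge0// ltW.
rewrite /C1 /C2 /C3 W1E W2E W1w1 W2w2 -/L -/k1 -/k2 -/k3 -!EFinM -!EFinD.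
(* The infima defining the prior distance and the two moments are approached to
   within [del], at possibly different points [a] and [b]. *)
apply/lee_addgt0Pr => e epos.
pose S := k1 + k2 * eps2 + k3 * eps3.
have S0 : 0 <= S by rewrite !addr_ge0// mulr_ge0.
pose del := e / (S + 1).
have S1 : 0 < S + 1 by rewrite ltr_wpDl.
have del0 : 0 < del by rewrite divr_gt0.
have [gamma gc gcost] : exists2 gamma, coupling P0r P0g gamma &
    (\int[gamma]_z (c z)%:E <= (eps1 + del)%:E)%E.
  have W1ge0 : (0 <= W1 E dE P0r P0g)%E.
    apply: le_ereal_inf_tmp => _ [g _ <-]; apply: integral_ge0 => z [Ez1 Ez2].
    by rewrite lee_fin d0.
  have W1fin : W1 E dE P0r P0g \is a fin_num.
    by rewrite ge0_fin_numE// (le_lt_trans W1_prior)// ltry.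
  have [_ [g gc <-] glt] := lb_ereal_inf_adherent del0 W1fin.
  exists g => //; rewrite -(costE _ _ _ gc P0rE P0gE); apply: (le_trans (ltW glt)).
  by rewrite EFinD leeD2r.
have [a Ea aN] := near1 _ del0; have [b Eb bN] := near2 _ del0.
have N2b : \int[P0g]_x (c (x, b) ^+ 2) <= N2 b ^+ 2.
  by rewrite sqr_sqrtr//; apply: mean_ge0 => x; exact: sqr_ge0.
have [G Gc Gcost] := posterior_transport c0 mc csym ctri cD a mPhi Phi01 mPsi Psi01
  lipr.1 lip (mulr_ge0 M0 eps30) (sqrtr_ge0 _) Qr_gt0 Qg_gt0 QrE QgE muE nuE gc
  gcost shift1 shift2 N2b.
apply: (@le_trans _ _ (\int[G]_(z in E `*` E) (dE z.1 z.2)%:E)%E).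
  by apply: ereal_inf_lbound; exists G.
rewrite (costE _ _ _ Gc PrE PgE); apply: (le_trans Gcost).
rewrite -EFinD lee_fin -/Qr -/Qg -/k1 -/(N1 a) -/(N2 b).
rewrite (_ : _ / (Qr * Qg) * N1 a * (M * eps2) = k2 * N1 a * eps2); last first.
  by rewrite /k2; ring.
rewrite (_ : Qg^-1 * N2 b * (M * eps3) = k3 * N2 b * eps3); last first.
  by rewrite /k3; ring.
have delS : S * del <= e.
  rewrite /del mulrCA ler_piMr ?(ltW epos)//.
  by rewrite ler_pdivrMr// mul1r lerDl.
have h2 : k2 * N1 a * eps2 <= k2 * (w1 + del) * eps2.
  by rewrite ler_wpM2r// ler_wpM2l// ltW.
have h3 : k3 * N2 b * eps3 <= k3 * (w2 + del) * eps3.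
  by rewrite ler_wpM2r// ler_wpM2l// ltW.
move: delS h2 h3; rewrite /S; lra.
Qed.
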